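(* Let $B\subset\mathbb{R}^4$ be an open set, let $f=(f^4,f^5,f^6,f^7):B\to T^4$ be a smooth map, let $X=B\times T^4$ carry the flat metric and the standard $\mathrm{Spin}(7)$-structure $\Phi$, and let $S=\{(x,f(x))\mid x\in B\}\subset X$ be the graph of $f$. Let $\nabla^B$ be a Hermitian connection of the trivial complex line bundle $B\times\mathbb{C}\to B$ with curvature $F^B_\nabla\in\sqrt{-1}\,\Omega^2(B)$. Let $\nabla$ be the real Fourier--Mukai transform of $(S,\nabla^B)$, a Hermitian connection of the trivial complex line bundle over $B\times(T^4)^*\cong X$, with curvature $F_\nabla\in\sqrt{-1}\,\Omega^2(X)$. Then the following are equivalent. (1) $S$ is a Cayley submanifold for an appropriate orientation, and the 2-form on $S$ obtained from $-\sqrt{-1}F^B_\nabla\in\Omega^2(B)$ via the diffeomorphism $B\to S$, $x\mapsto(x,f(x))$, is anti-self-dual with respect to the induced metric on $S$ and the orientation which makes $S$ Cayley. (2) $$\pi^2_7\Big(F_\nabla+\tfrac16 *F_\nabla^3\Big)=0\quad\text{and}\quad \pi^4_7\big(F_\nabla^2\big)=0 .$$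
   Context: Notation: $e^{i_1\cdots i_k}=e^{i_1}\wedge\cdots\wedge e^{i_k}$; powers of forms are wedge powers; $i(\cdot)$ is the interior product; $\alpha^\sharp$ is the metric dual of a 1-form $\alpha$. Setting: $T^4=\mathbb{R}^4/(2\pi\mathbb{Z})^4$. Coordinates on $B$ are $(x^0,x^1,x^2,x^3)$ and on $T^4$ are $(y^4,y^5,y^6,y^7)$. $X=B\times T^4$ has the flat product metric $\sum (dx^i)^2+\sum (dy^a)^2$. Set $(e^0,\dots,e^7)=(dx^0,\dots,dx^3,dy^4,\dots,dy^7)$, a positively oriented orthonormal coframe; $*$ is the Hodge star. Put $\varphi=e^{123}+e^{145}+e^{167}+e^{246}-e^{257}-e^{347}-e^{356}$ and $*_7\varphi=e^{4567}+e^{2367}+e^{2345}+e^{1357}-e^{1346}-e^{1256}-e^{1247}$. The standard $\mathrm{Spin}(7)$-structure is $\Phi=e^0\wedge\varphi+*_7\varphi$. Cayley: an oriented 4-dimensional submanifold is Cayley if it is calibrated by $\Phi$, i.e. the restriction of $\Phi$ to it equals its induced Riemannian volume form. Projections: $\pi^k_\ell:\Omega^k\to\Omega^k_\ell$ is the orthogonal projection (extended complex linearly) onto the forms with values in the subbundle of $\Lambda^kT^*X$ corresponding to the $\ell$-dimensional irreducible $\mathrm{Spin}(7)$-representation, where $\Lambda^2\cong W_7\oplus W_{21}$ and $\Lambda^4\cong W_1\oplus W_7\oplus W_{27}\oplus W_{35}$. Explicitly, pointwise, $\Lambda^2_7=\{\alpha\mid \Phi\wedge\alpha=3*\alpha\}$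 (so $\pi^2_7(\alpha)=\frac14(\alpha+*(\Phi\wedge\alpha))$) and $\Lambda^4_7=\{e^0\wedge i(\alpha^\sharp)*_7\varphi-\alpha\wedge\varphi\mid \alpha\in\mathrm{span}(e^1,\dots,e^7)\}$. Real Fourier--Mukai transform: write $\nabla^B=d+\sqrt{-1}\sum_{j=0}^3A^jdx^j$ with smooth $A^j:B\to\mathbb{R}$. Identify $B\times(T^4)^*$ with $X=B\times T^4$. Then $\nabla=d+\sqrt{-1}\sum_{j=0}^3A^jdx^j+\sqrt{-1}\sum_{a=4}^7 f^a\,dy^a$ on the trivial complex line bundle. Its curvature is $F_\nabla=F^B_\nabla+F^S_\nabla$ with $F^B_\nabla=\sqrt{-1}\sum_{i,j=0}^3\frac{\partial A^j}{\partial x^i}dx^i\wedge dx^j$ and $F^S_\nabla=\sqrt{-1}\sum_{i=0}^3\sum_{a=4}^7\frac{\partial f^a}{\partial x^i}\,dx^i\wedge dy^a$. (The components $f^a$ are defined modulo $2\pi$, so $\partial f^a/\partial x^i$ are well-defined functions on $B$.) *)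

(* Defs.v *)
From HB Require Import structures.
From mathcomp Require Import all_boot all_order all_algebra.
From mathcomp Require Import all_classical all_reals all_analysis.
From mathcomp Require Import generic_quotient complex.

Set Implicit Arguments.
Unset Strict Implicit.
Unset Printing Implicit Defensive.

Import Order.TTheory GRing.Theory Num.Theory.
Import numFieldNormedType.Exports.

Local Open Scope classical_set_scope.
Local Open Scope ring_scope.
Local Open Scope complex_scope.
Local Open Scope quotient_scope.

(* [eform n K] is the full exterior algebra on the coframe e^0, ..., e^(n-1):
  the coefficient of alpha at the set I = {i_1 < ... < i_k} is its coefficient
  on the monomial e^{i_1 ... i_k}. *)

Notation eform n K := {ffun {set 'I_n} -> K^o}.

Section Exterior.
Variables (n : nat) (K : comNzRingType).
Implicit Types (I J : {set 'I_n}) (alpha beta : eform n K).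

Definition basis_form I : eform n K := [ffun J => (J == I)%:R].

Definition covec (i : 'I_n) : eform n K := basis_form [set i]%SET.

Definition homogeneous (k : nat) alpha : Prop :=
  forall I, #|I| != k -> alpha I = 0.

(* e^I /\ e^J = shuffle_sign I J *: e^(I :|: J) for disjoint I and J: the
   exponent counts the inversions of the concatenation of I and J. *)
Definition shuffle_sign I J : K :=
  (-1) ^+ #|[set p : 'I_n * 'I_n | [&& p.1 \in I, p.2 \in J & (p.2 < p.1)%N]]%SET|.

Definition wedge alpha beta : eform n K :=
  [ffun I : {set 'I_n} => \sum_(J : {set 'I_n} | J \subset I)
     shuffle_sign J (I :\: J) * alpha J * beta (I :\: J)].

Definition wedge_pow alpha (k : nat) : eform n K :=
  iter k (wedge alpha) (basis_form finset.set0).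

(* Interior product: i(e_k)(e^k /\ e^J) = e^J for k \notin J. *)
Definition contract (v : 'rV[K]_n) alpha : eform n K :=
  [ffun J : {set 'I_n} => \sum_(k | k \notin J)
     v 0 k * shuffle_sign [set k] J * alpha (k |: J)].

End Exterior.

Arguments basis_form {n K} I.
Arguments covec {n K} i.

(* Pullback by the linear map K^m -> K^n with matrix M (acting on columns): the
   algebra morphism sending e^i to \sum_j M i j e^j; the wedge product over I is
   taken in increasing order. *)
Definition pull (n m : nat) (K : comNzRingType) (M : 'M[K]_(n, m))
    (alpha : eform n K) : eform m K :=
  \sum_(I : {set 'I_n}) alpha I *:
    \big[@wedge m K/basis_form finset.set0]_(i in I) (\sum_j M i j *: covec j).

Section Metric.
Variables (n : nat) (R : realType).
Implicit Types (g : 'M[R]_n) (alpha beta : eform n R).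

(* The inner product on forms induced by g: <e^I, e^J> is the (I, J) minor of
   the inverse of g. *)
Definition inner g alpha beta : R :=
  \sum_(I : {set 'I_n}) alpha I * pull (invmx g) beta I.

(* The orientation is that of e^0 /\ ... /\ e^(n-1) when [o] is false, and the
   opposite one when [o] is true. *)
Definition volume g (o : bool) : eform n R :=
  ((-1) ^+ o * Num.sqrt (\det g)) *: basis_form [set: 'I_n]%SET.

(* Characterised by wedge alpha (hodge g o beta) = inner g alpha beta *:
   volume g o, spelled out on the basis forms alpha = e^I. *)
Definition hodge g (o : bool) beta : eform n R :=
  \sum_(I : {set 'I_n})
    (shuffle_sign R I (~: I) * inner g (basis_form I) beta *
       volume g o [set: 'I_n]%SET) *: basis_form (~: I)%SET.

(* Some default value is returned if the projection does not exist, which does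
   not happen for a linear subspace W. *)
Definition orth_proj (W : set (eform n R)) alpha : eform n R :=
  xget 0 [set beta | W beta /\
    forall gamma, W gamma -> inner 1%:M (alpha - beta) gamma = 0].

End Metric.

Section Complexification.
Variables (n : nat) (R : realType).

Definition complexify (alpha : eform n R) : eform n R[i] :=
  [ffun I => (alpha I)%:C].

Definition re_form (alpha : eform n R[i]) : eform n R :=
  [ffun I => complex.Re (alpha I)].

Definition im_form (alpha : eform n R[i]) : eform n R :=
  [ffun I => complex.Im (alpha I)].

Definition clin (L : eform n R -> eform n R) (alpha : eform n R[i]) : eform n R[i] :=
  complexify (L (re_form alpha)) + 'i%C *: complexify (L (im_form alpha)).

Definition anti_self_dual (g : 'M[R]_n) (o : bool) (alpha : eform n R[i]) : Prop :=
  clin (hodge g o) alpha = - alpha.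

End Complexification.

Section Spin7.
Variable R : realType.

Definition monomial (s : seq nat) : eform 8 R :=
  \big[@wedge 8 R/basis_form finset.set0]_(i <- s) covec (inord i).

Local Notation e := monomial.

Definition phi : eform 8 R :=
  e [:: 1; 2; 3] + e [:: 1; 4; 5] + e [:: 1; 6; 7] + e [:: 2; 4; 6]
  - e [:: 2; 5; 7] - e [:: 3; 4; 7] - e [:: 3; 5; 6].

Definition star7_phi : eform 8 R :=
  e [:: 4; 5; 6; 7] + e [:: 2; 3; 6; 7] + e [:: 2; 3; 4; 5]
  + e [:: 1; 3; 5; 7] - e [:: 1; 3; 4; 6] - e [:: 1; 2; 5; 6]
  - e [:: 1; 2; 4; 7].

Definition Phi : eform 8 R := wedge (covec 0) phi + star7_phi.

Definition star8 : eform 8 R -> eform 8 R := hodge 1%:M false.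

Definition Lambda27 : set (eform 8 R) :=
  [set alpha | homogeneous 2 alpha /\ wedge Phi alpha = 3 *: star8 alpha].

Definition sharp (alpha : eform 8 R) : 'rV[R]_8 := \row_i alpha [set i]%SET.

Definition lambda4 (alpha : eform 8 R) : eform 8 R :=
  wedge (covec 0) (contract (sharp alpha) star7_phi) - wedge alpha phi.

Definition Lambda47 : set (eform 8 R) :=
  [set beta | exists c : 'I_7 -> R,
     beta = lambda4 (\sum_j c j *: covec (lift ord0 j))].

Definition pi27 : eform 8 R[i] -> eform 8 R[i] := clin (orth_proj Lambda27).
Definition pi47 : eform 8 R[i] -> eform 8 R[i] := clin (orth_proj Lambda47).

End Spin7.

Section Smooth.
Variables (n : nat) (R : realType).
Implicit Types (U : set 'rV[R]_n) (g : 'rV[R]_n -> R).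

Definition partial (i : 'I_n) g (x : 'rV[R]_n) : R :=
  'D_('e_i : 'rV[R]_n) g x.

Fixpoint Ck (k : nat) U g : Prop :=
  (forall x, U x -> {for x, continuous g}) /\
  if k is k'.+1 then
    forall i, (forall x, U x -> derivable g x 'e_i) /\
              Ck k' U (partial i g)
  else True.

Definition smooth U g : Prop := forall k, Ck k U g.

End Smooth.

Section Torus.
Variables (m : nat) (R : realType).

Definition torus_rel (x y : 'rV[R]_m) : bool :=
  `[< exists k : 'rV[int]_m, forall a, x 0 a - y 0 a = 2 * trigo.pi * (k 0 a)%:~R >].

Lemma torus_rel_refl : reflexive torus_rel.
Proof.
by move=> x; apply/asboolP; exists 0 => a; rewrite mxE subrr mulr0.
Qed.

Lemma torus_rel_sym : symmetric torus_rel.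
Proof.
suff sub x y : torus_rel x y -> torus_rel y x.
  by move=> x y; apply/idP/idP; apply: sub.
move=> /asboolP[k kE]; apply/asboolP; exists (- k) => a.
by rewrite mxE mulrNz mulrN -kE opprB.
Qed.

Lemma torus_rel_trans : transitive torus_rel.
Proof.
move=> y x z /asboolP[k kE] /asboolP[l lE]; apply/asboolP; exists (k + l) => a.
by rewrite mxE intrD mulrDr -kE -lE addrA subrK.
Qed.

Canonical torus_equiv : equiv_rel 'rV[R]_m :=
  EquivRel torus_rel torus_rel_refl torus_rel_sym torus_rel_trans.

Definition torus := {eq_quot torus_equiv}.

End Torus.

Arguments torus : clear implicits.

Section MapsToTorus.
Variables (n m : nat) (R : realType).
Implicit Types f : 'rV[R]_n -> torus m R.

Definition local_lift f (x : 'rV[R]_n) (g : 'rV[R]_n -> 'rV[R]_m) : Prop :=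
  exists U : set 'rV[R]_n, [/\ open U, U x,
    forall a, smooth U (fun y => g y 0 a) &
    forall y, U y -> f y = \pi_(torus m R) (g y)].

Definition smooth_to_torus (U : set 'rV[R]_n) f : Prop :=
  forall x, U x -> exists g, local_lift f x g.

(* Local lifts at x agree near x up to an additive constant in (2 pi Z)^m, so
   that their partial derivatives at x do not depend on the choice. *)
Definition torus_lift f (x : 'rV[R]_n) : 'rV[R]_n -> 'rV[R]_m :=
  xget (fun=> 0) [set g | local_lift f x g].

Definition torus_partial (i : 'I_n) f (a : 'I_m) (x : 'rV[R]_n) : R :=
  partial i (fun y => torus_lift f x y 0 a) x.

End MapsToTorus.

(* A 4-dimensional submanifold S is given by a parametrisation G; tensors on S
  and orientations of S are read on the parameter domain through G. *)

Section Submanifold.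
Variable R : realType.

Definition spaceX : Type := ('rV[R]_4 * torus 4 R)%type.

Implicit Types (B : set 'rV[R]_4) (G : 'rV[R]_4 -> spaceX) (o : 'rV[R]_4 -> bool).

Definition graph (f : 'rV[R]_4 -> torus 4 R) (x : 'rV[R]_4) : spaceX := (x, f x).

(* Matrix, acting on columns, of the differential of G, where the tangent spaces
   of X are identified with R^4 x R^4 = R^8 by the coframe dx^0, ..., dy^7. *)
Definition differential G (x : 'rV[R]_4) : 'M[R]_(8, 4) :=
  \matrix_(k < 4 + 4, i < 4)
    partial i (fun y => row_mx (G y).1 (torus_lift (fun z => (G z).2) x y) 0 k) x.

Definition induced_metric G (x : 'rV[R]_4) : 'M[R]_4 :=
  (differential G x)^T *m differential G x.

(* The orientation at G x is that of the frame (dG e_0, ..., dG e_3) or, if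
   [o x], the opposite one; it has to be locally constant along S. *)
Definition orientation B o : Prop :=
  forall x, B x -> \forall y \near x, o y = o x.

Definition cayley B G o : Prop :=
  forall x, B x -> pull (differential G x) (Phi R) = volume (induced_metric G x) (o x).

End Submanifold.

Section FourierMukai.
Variable R : realType.
Implicit Types (f : 'rV[R]_4 -> torus 4 R) (A : 'I_4 -> 'rV[R]_4 -> R).

(* Curvature of d + i \sum_j A^j dx^j, written in a given coframe dx. *)
Definition curvature_base n (dx : 'I_4 -> eform n R[i]) A (x : 'rV[R]_4) : eform n R[i] :=
  'i%C *: \sum_(i < 4) \sum_(j < 4) (partial i (A j) x)%:C *: wedge (dx i) (dx j).

Definition FB A (x : 'rV[R]_4) : eform 4 R[i] := curvature_base covec A x.

Definition dx (i : 'I_4) : eform 8 R[i] := covec (lshift 4 i).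
Definition dy (a : 'I_4) : eform 8 R[i] := covec (rshift 4 a).

(* f = (f^4, ..., f^7) is indexed by 'I_4, f^(4 + a) being the component a. *)
Definition FS f (x : 'rV[R]_4) : eform 8 R[i] :=
  'i%C *: \sum_(i < 4) \sum_(a < 4) (torus_partial i f a x)%:C *: wedge (dx i) (dy a).

Definition curvature f A (p : spaceX R) : eform 8 R[i] :=
  curvature_base dx A p.1 + FS f p.1.

End FourierMukai.

(* Main.v *)
(* Fix a point, write F = i omega with omega = beta + mu, beta the curvature of
   the base and mu the mixed part, let D be the differential of x |-> (x, f x),
   g = D^T D, and let p be the value of Phi on the frame given by D. With w_k
   and v_k orthogonal bases of Lambda^2_7 and Lambda^4_7, condition (2) says that
     E_k = 6 <omega - star omega^3 / 6, w_k>  and  E'_k = <omega^2, v_k>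
   vanish for k = 1, ..., 7. Seven of these, E_4, ..., E_7, E'_1, E'_2, E'_3,
   involve only D, and
     36 det g = 36 p^2 + sum_{k > 3} E_k^2 + 9 sum_{k <= 3} E'_k^2,
   so that they vanish iff p = +-sqrt (det g), which is the Cayley condition. The
   other seven are linear in beta; 36 (pull g (star beta) + p beta), star being the
   flat star on R^4, is a linear combination of them, and its inner product with
   star beta is sum_{k <= 3} E_k^2 + 9 sum_{k > 3} E'_k^2. Hence
   they vanish iff pull g (star beta) = - p beta, which for p = +-sqrt (det g) is
   anti-self-duality with respect to g and the orientation given by the sign of
   p. Since p is continuous and does not vanish, this sign is locally constant.
   The polynomial identities are checked by evaluation on symbolic forms. *)

Require Import Defs.
From HB Require Import structures.
From mathcomp Require Import all_boot all_order all_algebra.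
From mathcomp Require Import all_classical all_reals all_analysis.
From mathcomp Require Import generic_quotient complex.
From mathcomp Require Import ring.
Set Implicit Arguments.
Unset Strict Implicit.
Unset Printing Implicit Defensive.
Import Order.TTheory GRing.Theory Num.Theory.
Import numFieldNormedType.Exports.
Local Open Scope classical_set_scope.
Local Open Scope ring_scope.
Local Open Scope complex_scope.

(** * Exterior algebra *)

Section ExteriorAlgebra.
Variables (n : nat) (K : comNzRingType).
Implicit Types (I J : {set 'I_n}) (a b c : eform n K) (x : K).

Lemma ffunZE (T : finType) (h : {ffun T -> K^o}) x t : (x *: h) t = x * h t.
Proof. by rewrite ffunE. Qed.

Lemma wedgeDl a b c : wedge (a + b) c = wedge a c + wedge b c.
Proof.
apply/ffunP => I; rewrite !ffunE -big_split /=; apply: eq_bigr => J _.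
by rewrite ffunE mulrDr mulrDl.
Qed.

Lemma wedgeDr a b c : wedge c (a + b) = wedge c a + wedge c b.
Proof.
apply/ffunP => I; rewrite !ffunE -big_split /=; apply: eq_bigr => J _.
by rewrite ffunE mulrDr.
Qed.

Lemma wedgeZl x a b : wedge (x *: a) b = x *: wedge a b.
Proof.
apply/ffunP => I; rewrite ffunZE !ffunE mulr_sumr; apply: eq_bigr => J _.
by rewrite ffunZE mulrCA !mulrA.
Qed.

Lemma wedgeZr x a b : wedge a (x *: b) = x *: wedge a b.
Proof.
apply/ffunP => I; rewrite ffunZE !ffunE mulr_sumr; apply: eq_bigr => J _.
by rewrite ffunZE mulrCA.
Qed.

Lemma wedge0l a : wedge 0 a = 0.
Proof. by rewrite -{1}(scale0r (0 : eform n K)) wedgeZl scale0r. Qed.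

Lemma wedge0r a : wedge a 0 = 0.
Proof. by rewrite -{1}(scale0r (0 : eform n K)) wedgeZr scale0r. Qed.

Lemma wedge_suml (T : Type) (r : seq T) (F : T -> eform n K) a :
  wedge (\sum_(t <- r) F t) a = \sum_(t <- r) wedge (F t) a.
Proof. by elim/big_rec2: _ => [|t y1 y2 _ <-]; rewrite ?wedge0l ?wedgeDl. Qed.

Lemma wedge_sumr (T : Type) (r : seq T) (F : T -> eform n K) a :
  wedge a (\sum_(t <- r) F t) = \sum_(t <- r) wedge a (F t).
Proof. by elim/big_rec2: _ => [|t y1 y2 _ <-]; rewrite ?wedge0r ?wedgeDr. Qed.

Lemma basis_formE I J : (basis_form I : eform n K) J = (J == I)%:R.
Proof. by rewrite ffunE. Qed.

Lemma basis_form_sum a : a = \sum_I a I *: basis_form I.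
Proof.
apply/ffunP => J; rewrite sum_ffunE (bigD1 J) //= ffunZE basis_formE eqxx mulr1.
rewrite big1 ?addr0 // => I /negPf; rewrite ffunZE basis_formE eq_sym => ->.
by rewrite mulr0.
Qed.

Lemma wedge_basis I J : wedge (basis_form I) (basis_form J) =
  if [disjoint I & J] then shuffle_sign K I J *: basis_form (I :|: J) else 0.
Proof.
apply/ffunP => L; rewrite ffunE.
have [IL|nIL] := boolP (I \subset L); last first.
  rewrite big1; last first.
    move=> I' I'L; rewrite !basis_formE; case: eqP => [I'I|_]; last by rewrite mulr0 mul0r.
    by rewrite -I'I I'L in nIL.
  case: ifP => _; last by rewrite ffunE.
  rewrite ffunZE basis_formE; case: eqP => [LE|_]; last by rewrite mulr0.
  by rewrite LE finset.subsetUl in nIL.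
rewrite (bigD1 I) //= big1 ?addr0; last first.
  by move=> I' /andP[_ /negPf nI]; rewrite !basis_formE nI mulr0 mul0r.
rewrite !basis_formE eqxx mulr1; case: ifP => [IJ|nIJ].
  rewrite ffunZE basis_formE; case: eqP => [<-|nE].
    by rewrite finset.setDE finset.setUIr finset.setUCr finset.setIT (finset.setUidPr IL) eqxx.
  case: eqP => [LE|_]; last by rewrite !mulr0.
  case: nE; rewrite LE finset.setDUl finset.setDv finset.set0U.
  by apply/finset.setDidPl; rewrite disjoint_sym.
rewrite [RHS]ffunE; case: eqP => [JE|_]; last by rewrite mulr0.
move: nIJ; rewrite -JE -finset.setI_eq0 finset.setDE finset.setICA finset.setICr.
by rewrite finset.setI0 eqxx.
Qed.

End ExteriorAlgebra.

Section Pull.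
Variables (n m : nat) (K : comNzRingType) (M : 'M[K]_(n, m)).
Implicit Types (a b : eform n K) (x : K).

Lemma pullD a b : pull M (a + b) = pull M a + pull M b.
Proof.
by rewrite /pull -big_split; apply: eq_bigr => I _; rewrite ffunE scalerDl.
Qed.

Lemma pullZ x a : pull M (x *: a) = x *: pull M a.
Proof.
by rewrite /pull scaler_sumr; apply: eq_bigr => I _; rewrite ffunZE scalerA.
Qed.

Lemma pull0 : pull M 0 = 0.
Proof. by rewrite -{1}(scale0r (0 : eform n K)) pullZ scale0r. Qed.

Lemma pull_sum (T : Type) (r : seq T) (P : pred T) (F : T -> eform n K) :
  pull M (\sum_(t <- r | P t) F t) = \sum_(t <- r | P t) pull M (F t).
Proof. by elim/big_rec2: _ => [|t y1 y2 _ <-]; rewrite ?pull0 ?pullD. Qed.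

Lemma pull_basis I : pull M (basis_form I) =
  \big[@wedge m K/basis_form finset.set0]_(i in I) (\sum_j M i j *: covec j).
Proof.
rewrite /pull (bigD1 I) //= basis_formE eqxx scale1r big1 ?addr0 // => J.
by rewrite basis_formE => /negPf ->; rewrite scale0r.
Qed.

End Pull.

(** * Symbolic forms *)

(* A polynomial with integer coefficients is a list of monomials, each given by
   its coefficient and the list of its variables; a form with polynomial
   coefficients is a list of terms [(q, [:: i_1; ...; i_k])], which stands for
   [q] times [e^I] with I = {i_1, ..., i_k} whatever the order of the list. *)
Section SymbolicForms.

Definition monom : Type := int * seq nat.
Definition spoly : Type := seq monom.
Definition sform : Type := seq (monom * seq nat).

Definition mul_monom (p q : monom) : monom := (p.1 * q.1, p.2 ++ q.2).
Definition sign_monom (b : bool) (p : monom) : monom :=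
  (if b then - p.1 else p.1, p.2).

Definition sscale (p : monom) (F : sform) : sform :=
  [seq (mul_monom p t.1, t.2) | t <- F].

Definition sone : sform := [:: ((1, [::]), [::])].
Definition scovec (i : nat) : sform := [:: ((1, [::]), [:: i])].
Definition sopp : sform -> sform := sscale (-1, [::]).

Variable n : nat.

(** Only the indices below [n] are compared, so that neither order nor repetition in the lists
    matters, as for the sets [ord_set n s]. *)
Definition same_set (s t : seq nat) : bool :=
  all (fun i => (i \in s) == (i \in t)) (iota 0 n).

Definition disjoint_set (s t : seq nat) : bool :=
  all (fun i => ~~ ((i \in s) && (i \in t))) (iota 0 n).

Definition union_set (s t : seq nat) : seq nat :=
  [seq i <- iota 0 n | (i \in s) || (i \in t)].

Definition compl_set (s : seq nat) : seq nat := [seq i <- iota 0 n | i \notin s].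

Definition inversions (s t : seq nat) : nat :=
  sumn [seq count (fun j => [&& i \in s, j \in t & (j < i)%N]) (iota 0 n) | i <- iota 0 n].

Definition swedge1 (t u : monom * seq nat) : monom * seq nat :=
  (sign_monom (odd (inversions t.2 u.2)) (mul_monom t.1 u.1), union_set t.2 u.2).

Definition swedge (F G : sform) : sform :=
  flatten [seq [seq swedge1 t u | u <- G & disjoint_set t.2 u.2] | t <- F].

Definition sstar (F : sform) : sform :=
  [seq (sign_monom (odd (inversions t.2 (compl_set t.2))) t.1, compl_set t.2) | t <- F].

Definition scontract (k : nat) (F : sform) : sform :=
  [seq (sign_monom (odd (inversions [:: k] [seq i <- t.2 | i != k])) t.1,
        [seq i <- t.2 | i != k]) | t <- F & k \in t.2].

Definition scoef (F : sform) (s : seq nat) : spoly :=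
  [seq t.1 | t <- F & same_set t.2 s].

Definition sinner (F G : sform) : spoly :=
  flatten [seq [seq mul_monom t.1 u.1 | u <- G & same_set t.2 u.2] | t <- F].

Definition spull (m : nat) (r : nat -> sform) (F : sform) : sform :=
  flatten [seq sscale t.1 (foldr (fun i => swedge (r i)) sone
                             [seq i <- iota 0 m | i \in t.2]) | t <- F].

End SymbolicForms.

Section Denotation.
Variables (K : comNzRingType) (c : nat -> K).
Implicit Types (p q : monom) (F G : sform) (P Q : spoly).

Definition ev p : K := p.1%:~R * \prod_(v <- p.2) c v.
Definition eval P : K := \sum_(p <- P) ev p.

Lemma ev_mul p q : ev (mul_monom p q) = ev p * ev q.
Proof. by rewrite /ev /= big_cat /= intrM mulrACA. Qed.

Lemma ev_sign b p : ev (sign_monom b p) = (-1) ^+ b * ev p.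
Proof. by case: b; rewrite /ev /= ?expr1 ?expr0 ?mul1r // mulN1r mulrNz mulNr. Qed.

Lemma ev_const z : ev (z, [::]) = z%:~R.
Proof. by rewrite /ev big_nil mulr1. Qed.

Variable n : nat.

Definition ord_set (s : seq nat) : {set 'I_n} := [set i : 'I_n | val i \in s].

Definition denote F : eform n K :=
  \sum_(t <- F) ev t.1 *: basis_form (ord_set t.2).

Lemma forall_iota (P : pred nat) :
  reflect (forall i : 'I_n, P i) (all P (iota 0 n)).
Proof.
apply: (iffP allP) => [h i|h i]; first by apply: h; rewrite mem_iota ltn_ord.
by rewrite mem_iota add0n => /andP[_ ilt]; exact: (h (Ordinal ilt)).
Qed.

Lemma same_setP s t : same_set n s t = (ord_set s == ord_set t).
Proof.
apply/forall_iota/eqP => [h|h i]; last by have /setP/(_ i) := h; rewrite !inE => ->.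
by apply/setP => i; rewrite !inE (eqP (h i)).
Qed.

Lemma disjoint_ordP s t : disjoint_set n s t = [disjoint ord_set s & ord_set t]%B.
Proof.
rewrite -finset.setI_eq0; apply/forall_iota/eqP => [h|/setP h i].
  by apply/setP => i; rewrite !inE (negPf (h i)).
by have := h i; rewrite !inE => ->.
Qed.

Lemma ord_setU s t : ord_set (union_set n s t) = ord_set s :|: ord_set t.
Proof.
by apply/setP => i; rewrite !inE /union_set mem_filter mem_iota leq0n ltn_ord !andbT.
Qed.

Lemma ord_setC s : ord_set (compl_set n s) = (~: ord_set s)%SET.
Proof.
by apply/setP => i; rewrite !inE /compl_set mem_filter mem_iota leq0n ltn_ord !andbT.
Qed.

Lemma ord_setD1 (k : 'I_n) s :
  ord_set [seq i <- s | i != k :> nat] = (ord_set s :\ k)%SET.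
Proof. by apply/setP => i; rewrite !inE mem_filter. Qed.

Lemma ord_set1 (i : 'I_n) : ord_set [:: val i] = [set i]%SET.
Proof. by apply/setP => j; rewrite !inE. Qed.

Lemma ord_set0 : ord_set [::] = finset.set0.
Proof. by apply/setP => j; rewrite !inE. Qed.

Lemma shuffle_sign_inversions s t :
  shuffle_sign K (ord_set s) (ord_set t) = (-1) ^+ odd (inversions n s t).
Proof.
rewrite signr_odd /shuffle_sign; congr (_ ^+ _).
have iotaE : iota 0 n = index_iota 0 n by rewrite /index_iota subn0.
rewrite -sum1_card /inversions sumnE big_map iotaE big_mkord.
under [RHS]eq_bigr => i _ do rewrite -sum1_count big_mkord.
rewrite pair_big_dep /=.
by apply: eq_bigl => -[i j]; rewrite !inE.
Qed.

Lemma denote_cat F G : denote (F ++ G) = denote F + denote G.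
Proof. exact: big_cat. Qed.

Lemma denote_sscale p F : denote (sscale p F) = ev p *: denote F.
Proof.
rewrite /denote big_map scaler_sumr; apply: eq_bigr => t _ /=.
by rewrite ev_mul scalerA.
Qed.

Lemma denote_sopp F : denote (sopp F) = - denote F.
Proof. by rewrite denote_sscale ev_const scaleN1r. Qed.

Lemma denote_sone : denote (sone) = basis_form finset.set0.
Proof. by rewrite /denote big_seq1 /= ev_const scale1r ord_set0. Qed.

Lemma denote_scovec (i : 'I_n) : denote (scovec i) = covec i.
Proof. by rewrite /denote big_seq1 /= ev_const scale1r ord_set1. Qed.

Lemma denote_flatten (T : Type) (r : seq T) (f : T -> sform) :
  denote (flatten [seq f t | t <- r]) = \sum_(t <- r) denote (f t).
Proof.
elim: r => [|t r ih] /=; first by rewrite big_nil /denote big_nil.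
by rewrite denote_cat big_cons ih.
Qed.

Lemma denote_swedge F G : denote (swedge n F G) = wedge (denote F) (denote G).
Proof.
rewrite denote_flatten wedge_suml; apply: eq_bigr => t _.
rewrite /denote big_map big_filter wedge_sumr big_mkcond; apply: eq_bigr => u _.
rewrite wedgeZl wedgeZr wedge_basis disjoint_ordP; case: ifP => _; last by rewrite !scaler0.
rewrite /= ord_setU ev_sign shuffle_sign_inversions scalerA scalerA; congr (_ *: _).
by rewrite ev_mul mulrC.
Qed.

(** The Hodge star of the standard metric and orientation, free of square roots and inverses, so
    that it makes sense over any commutative ring. *)
Definition flat_star (a : eform n K) : eform n K :=
  \sum_(I : {set 'I_n}) (shuffle_sign K I (~: I) * a I) *: basis_form (~: I)%SET.

Lemma flat_star_is_linear : linear flat_star.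
Proof.
move=> x a b; rewrite /flat_star scaler_sumr -big_split; apply: eq_bigr => I _ /=.
rewrite !ffunE mulrDr scalerDl; congr (_ + _).
by rewrite scalerA mulrCA.
Qed.

HB.instance Definition _ :=
  GRing.isLinear.Build K (eform n K) (eform n K) _ flat_star flat_star_is_linear.

Lemma flat_star0 : flat_star 0 = 0.
Proof. exact: linear0. Qed.

Lemma flat_starZ x (a : eform n K) : flat_star (x *: a) = x *: flat_star a.
Proof. exact: linearZ. Qed.

Lemma flat_star_sum (T : Type) (r : seq T) (F : T -> eform n K) :
  flat_star (\sum_(t <- r) F t) = \sum_(t <- r) flat_star (F t).
Proof. exact: linear_sum. Qed.

Lemma flat_star_basis I :
  flat_star (basis_form I) = shuffle_sign K I (~: I) *: basis_form (~: I)%SET.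
Proof.
rewrite /flat_star (bigD1 I) //= basis_formE eqxx mulr1 big1 ?addr0 // => J.
by rewrite basis_formE => /negPf ->; rewrite mulr0 scale0r.
Qed.

Lemma denote_sstar F : denote (sstar n F) = flat_star (denote F).
Proof.
rewrite /denote big_map flat_star_sum; apply: eq_bigr => t _ /=.
rewrite flat_starZ flat_star_basis ord_setC ev_sign -ord_setC.
by rewrite shuffle_sign_inversions scalerA mulrC.
Qed.

Lemma eval_scoef F s : eval (scoef n F s) = denote F (ord_set s).
Proof.
rewrite /eval big_map big_filter big_mkcond sum_ffunE; apply: eq_bigr => t _.
rewrite ffunZE basis_formE same_setP eq_sym.
by case: eqP => _; rewrite ?mulr1 ?mulr0.
Qed.

Lemma eval_sinner F G :
  eval (sinner n F G) = \sum_I denote F I * denote G I.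
Proof.
transitivity (\sum_(t <- F) \sum_(u <- G)
    ev t.1 * ev u.1 * (ord_set t.2 == ord_set u.2)%:R).
  rewrite /eval /sinner; elim: F => [|t F ih] /=; first by rewrite !big_nil.
  rewrite big_cat big_cons ih; congr (_ + _).
  rewrite big_map big_filter big_mkcond; apply: eq_bigr => u _.
  by rewrite same_setP; case: ifP => _; rewrite ?mulr1 ?mulr0 // ev_mul.
under [RHS]eq_bigr => I _ do rewrite !sum_ffunE mulr_suml.
rewrite [RHS]exchange_big; apply: eq_bigr => t _ /=.
under [RHS]eq_bigr => I _ do rewrite mulr_sumr.
rewrite [RHS]exchange_big; apply: eq_bigr => u _ /=.
rewrite [RHS](bigD1 (ord_set t.2)) //= [X in _ + X]big1 ?addr0; last first.
  by move=> I /negPf nI; rewrite !ffunZE !basis_formE nI mulr0 mul0r.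
by rewrite !ffunZE !basis_formE eqxx mulr1 [RHS]mulrA.
Qed.

End Denotation.

Section SymbolicMaps.
Variables (K : comNzRingType) (c : nat -> K).

Lemma denote_foldr_swedge m (r : nat -> sform) (s : seq nat) :
  denote c m (foldr (fun i => swedge m (r i)) (sone) s) =
  \big[@wedge m K/basis_form finset.set0]_(i <- s) denote c m (r i).
Proof.
elim: s => [|i s ih] /=; first by rewrite big_nil denote_sone.
by rewrite big_cons denote_swedge ih.
Qed.

Lemma denote_spull n m (M : 'M[K]_(n, m)) (r : nat -> sform) (F : sform) :
  (forall i : 'I_n, denote c m (r i) = \sum_j M i j *: covec j) ->
  denote c m (spull m n r F) = pull M (denote c n F).
Proof.
move=> rE; rewrite denote_flatten pull_sum; apply: eq_bigr => t _.
rewrite pullZ pull_basis denote_sscale denote_foldr_swedge big_filter; congr (_ *: _).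
have -> : iota 0 n = index_iota 0 n by rewrite /index_iota subn0.
by rewrite big_mkord; apply: eq_big => [i|i _]; rewrite ?inE ?rE.
Qed.

Section Contraction.
Variables (n : nat).
Implicit Types (a b : eform n K) (v : 'rV[K]_n).

Lemma contractDr v a b : Defs.contract v (a + b) = Defs.contract v a + Defs.contract v b.
Proof.
apply/ffunP => I; rewrite !ffunE -big_split /=; apply: eq_bigr => k _.
by rewrite ffunE mulrDr.
Qed.

Lemma contractZr v x a : Defs.contract v (x *: a) = x *: Defs.contract v a.
Proof.
apply/ffunP => I; rewrite ffunZE !ffunE mulr_sumr; apply: eq_bigr => k _.
by rewrite ffunZE mulrCA.
Qed.

Lemma contractDl v w a : Defs.contract (v + w) a = Defs.contract v a + Defs.contract w a.
Proof.
apply/ffunP => I; rewrite !ffunE -big_split /=; apply: eq_bigr => k _.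
by rewrite mxE !mulrDl.
Qed.

Lemma contractZl v x a : Defs.contract (x *: v) a = x *: Defs.contract v a.
Proof.
apply/ffunP => I; rewrite ffunZE !ffunE mulr_sumr; apply: eq_bigr => k _.
by rewrite mxE !mulrA.
Qed.

Lemma contract0r v : Defs.contract v (0 : eform n K) = 0.
Proof. by rewrite -{1}(scale0r (0 : eform n K)) contractZr scale0r. Qed.

Lemma contract_sumr v (T : Type) (r : seq T) (F : T -> eform n K) :
  Defs.contract v (\sum_(t <- r) F t) = \sum_(t <- r) Defs.contract v (F t).
Proof. by elim/big_rec2: _ => [|t y1 y2 _ <-]; rewrite ?contract0r ?contractDr. Qed.

Lemma contract_basis (k : 'I_n) I : Defs.contract (\row_j (j == k)%:R) (basis_form I) =
  if k \in I then shuffle_sign K [set k] (I :\ k) *: basis_form (I :\ k)%SET else 0.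
Proof.
apply/ffunP => J; rewrite ffunE.
rewrite (eq_bigr (fun j => if j == k then
    shuffle_sign K [set k] J * (k |: J == I)%SET%:R else 0)); last first.
  move=> j _; rewrite mxE basis_formE.
  by case: eqP => [->|_]; rewrite ?mul1r ?mul0r.
rewrite -big_mkcondr /=.
have [kI|nkI] := boolP (k \in I); last first.
  rewrite ffunE big1 // => j _; case: eqP => [kJI|_]; last by rewrite mulr0.
  by rewrite -kJI !inE eqxx in nkI.
rewrite ffunZE basis_formE; have [kJ|nkJ] := boolP (k \in J).
  rewrite big1; last by move=> j /andP[+ /eqP jk]; rewrite jk kJ.
  by case: eqP => [JE|_]; rewrite ?mulr0 //; rewrite JE !inE eqxx in kJ.
rewrite (big_pred1 k); last by move=> j /=; case: eqP => [->|_]; rewrite ?nkJ ?andbF.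
have -> : (k |: J == I)%SET = (J == (I :\ k)%SET).
  apply/eqP/eqP => [<-|->]; first by rewrite finset.setU1K.
  by rewrite finset.setD1K.
by case: eqP => [->|_]; rewrite ?mulr0.
Qed.

Lemma denote_scontract (k : 'I_n) (F : sform) :
  denote c n (scontract n k F) = Defs.contract (\row_j (j == k)%:R) (denote c n F).
Proof.
rewrite /denote big_map big_filter contract_sumr big_mkcond; apply: eq_bigr => t _.
rewrite contractZr contract_basis inE /=; case: ifP => kt; last by rewrite scaler0.
rewrite ord_setD1 ev_sign scalerA mulrC; congr (_ * _ *: _).
by rewrite -shuffle_sign_inversions ord_setD1 ord_set1.
Qed.

End Contraction.

End SymbolicMaps.

(** * Hodge star and projections *)

Section Metric.
Variables (n : nat) (R : realType).
Implicit Types (g : 'M[R]_n) (a b : eform n R).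

(** The product runs through [I] in increasing order, so prepending a factor creates no inversion
    and every shuffle sign is 1. *)
Lemma wedge_covec (I : {set 'I_n}) :
  \big[@wedge n R/basis_form finset.set0]_(i in I) covec i = basis_form I.
Proof.
rewrite -big_filter.
have -> : [seq i <- index_enum 'I_n | i \in I] =
          [seq i <- enum 'I_n | i \in I].
  by rewrite enumT.
have : sorted ltn [seq val i | i <- enum 'I_n & i \in I].
  apply: (@subseq_sorted _ ltn); first exact: ltn_trans.
    exact: map_subseq (filter_subseq _ _).
  by rewrite val_enum_ord iota_ltn_sorted.
rewrite [in RHS](_ : I = [set i in [seq i <- enum 'I_n | i \in I]]%SET); last first.
  by apply/setP => i; rewrite !inE mem_filter mem_enum andbT.
(* Generalised to any strictly increasing list, so that induction can remove the head. *)
move: [seq i <- enum 'I_n | _] => s.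
elim: s => [|i s ih] /= => [_|pis].
  by rewrite big_nil; congr basis_form; apply/setP => i; rewrite !inE.
rewrite big_cons ih ?(path_sorted pis) // /covec wedge_basis.
have ltis (j : 'I_n) : j \in s -> (i < j)%N.
  move=> js; have /allP := order_path_min ltn_trans pis.
  by apply; apply: map_f.
have is_ : i \notin s by apply/negP => /ltis; rewrite ltnn.
rewrite disjoints1 inE is_ /shuffle_sign.
rewrite (_ : #|_| = 0%N) ?expr0 ?scale1r.
  by congr basis_form; apply/setP => j; rewrite !inE.
apply: eq_card0 => -[j k]; rewrite !inE /=; apply/negP => /and3P[/eqP -> ks].
by rewrite ltnNge ltnW // ltis.
Qed.

Lemma pull1 a : pull 1%:M a = a.
Proof.
rewrite [RHS]basis_form_sum /pull; apply: eq_bigr => I _; congr (_ *: _).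
rewrite -(wedge_covec I); apply: eq_bigr => i _.
rewrite (bigD1 i) //= mxE eqxx scale1r big1 ?addr0 // => j /negPf ji.
by rewrite mxE eq_sym ji scale0r.
Qed.

Lemma inner1E a b : inner 1%:M a b = \sum_I a I * b I.
Proof. by rewrite /inner invmx1; apply: eq_bigr => I _; rewrite pull1. Qed.

Lemma inner_basis g I a : inner g (basis_form I) a = pull (invmx g) a I.
Proof.
rewrite /inner (bigD1 I) //= basis_formE eqxx mul1r big1 ?addr0 // => J /negPf JI.
by rewrite basis_formE JI mul0r.
Qed.

(** The metric enters the star in two ways only: through raising indices, which is the pullback by
    [invmx g], and through the volume factor. *)
Lemma hodgeE g o a : hodge g o a =
  ((-1) ^+ o * Num.sqrt (\det g)) *: flat_star (pull (invmx g) a).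
Proof.
rewrite /hodge /flat_star scaler_sumr; apply: eq_bigr => I _.
rewrite inner_basis scalerA /volume ffunZE basis_formE eqxx mulr1.
by congr (_ *: _); rewrite mulrC.
Qed.

Lemma hodge1 a : hodge 1%:M false a = flat_star a.
Proof. by rewrite hodgeE det1 sqrtr1 expr0 mulr1 scale1r invmx1 pull1. Qed.

Lemma inner1_sumr (T : Type) (r : seq T) (w : T -> eform n R) (x : T -> R) a :
  inner 1%:M a (\sum_(k <- r) x k *: w k) = \sum_(k <- r) x k * inner 1%:M a (w k).
Proof.
rewrite inner1E; under eq_bigr => I _ do rewrite sum_ffunE mulr_sumr.
rewrite exchange_big; apply: eq_bigr => k _ /=.
by rewrite inner1E mulr_sumr; apply: eq_bigr => I _; rewrite ffunZE mulrCA.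
Qed.

Lemma inner1C a b : inner 1%:M a b = inner 1%:M b a.
Proof. by rewrite !inner1E; apply: eq_bigr => I _; rewrite mulrC. Qed.

Lemma inner1D a b d : inner 1%:M (a + b) d = inner 1%:M a d + inner 1%:M b d.
Proof.
by rewrite !inner1E -big_split; apply: eq_bigr => I _; rewrite ffunE mulrDl.
Qed.

Lemma inner1Z x a b : inner 1%:M (x *: a) b = x * inner 1%:M a b.
Proof.
by rewrite !inner1E mulr_sumr; apply: eq_bigr => I _; rewrite ffunZE mulrA.
Qed.

Lemma inner1_eq0 a : inner 1%:M a a = 0 -> a = 0.
Proof.
rewrite inner1E => aa0; apply/ffunP => I; rewrite ffunE.
have : a I * a I = 0.
  by apply: (psumr_eq0P _ aa0) => // J _; rewrite -expr2 sqr_ge0.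
by move/eqP; rewrite mulf_eq0 orbb => /eqP.
Qed.

(** The projection is the sum of the <a, w_k> / <w_k, w_k> w_k. The second hypothesis says at once
    that the [w k] are mutually orthogonal and that none of them has norm zero. *)
Lemma orth_proj_eq0 (I : finType) (w : I -> eform n R) (W : set (eform n R)) a :
  (forall b, W b <-> exists x : I -> R, b = \sum_k x k *: w k) ->
  (forall k l, inner 1%:M (w k) (w l) != 0 <-> k = l) ->
  orth_proj W a = 0 <-> forall k, inner 1%:M a (w k) = 0.
Proof.
move=> WE ww.
have Ww k : W (w k).
  apply/WE; exists (fun l => (l == k)%:R); rewrite (bigD1 k) //= eqxx scale1r.
  by rewrite big1 ?addr0 // => l /negPf ->; rewrite scale0r.
pose x k := inner 1%:M a (w k) / inner 1%:M (w k) (w k).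
have projP : [set b | W b /\ forall d, W d -> inner 1%:M (a - b) d = 0]
    (\sum_k x k *: w k).
  split; first by apply/WE; exists x.
  move=> _ /WE[y ->]; rewrite inner1_sumr big1 // => k _.
  rewrite inner1D -scaleN1r inner1Z [X in -1 * X]inner1C inner1_sumr.
  rewrite (bigD1 k) //= big1; last first.
    move=> l lk; have /negPn/eqP -> : ~~ (inner 1%:M (w k) (w l) != 0).
      by apply/negP => /ww kl; rewrite kl eqxx in lk.
    by rewrite mulr0.
  rewrite addr0 /x divfK; last exact/ww.
  by rewrite mulN1r subrr mulr0.
(* The explicit projection rules out the default value 0 of [xget], which would make the left side
   true for every [a]. *)
rewrite /orth_proj; case: xgetP => [b _ [Wb bP] | /(_ _ projP)[]].
split=> [b0 k|a0]; first by have := bP _ (Ww k); rewrite b0 subr0.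
(* Both [a] and [a - b] are orthogonal to [b], which lies in [W]; hence [b] is orthogonal to
   itself. *)
apply: inner1_eq0; have [y bE] := (WE b).1 Wb.
have ab0 : inner 1%:M a b = 0.
  by rewrite bE inner1_sumr big1 // => k _; rewrite a0 mulr0.
have := bP _ Wb; rewrite inner1D ab0 add0r -scaleN1r inner1Z mulN1r => /eqP.
by rewrite oppr_eq0 => /eqP.
Qed.

End Metric.

(** * Reflection of polynomial identities *)

Section PolynomialIdentities.

Definition popp (P : spoly) : spoly := [seq (- p.1, p.2) | p <- P].
Definition pmul (P Q : spoly) : spoly := 
  flatten [seq [seq mul_monom p q | q <- Q] | p <- P].
Definition pconst (z : int) : spoly := [:: (z, [::])].

Fixpoint lexleq (s t : seq nat) : bool :=
  match s, t with
  | x :: s', y :: t' => (x < y)%N || (x == y) && lexleq s' t'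
  | _, _ => nilp s
  end.

Definition collect (p : monom) (P : spoly) : spoly :=
  if P is q :: P' then
    if p.2 == q.2 then (p.1 + q.1, p.2) :: P' else p :: P
  else [:: p].

(** Sorting the variables of each monomial and then the monomials makes like terms adjacent, where
    [collect] can merge them. *)
Definition normal (P : spoly) : spoly :=
  [seq p <- foldr collect [::] (sort (fun p q => lexleq p.2 q.2)
     [seq (p.1, sort leq p.2) | p <- P]) | p.1 != 0].

Definition poly_eqb (P Q : spoly) : bool := nilp (normal (P ++ popp Q)).

Definition form_eqb (n : nat) (F G : sform) : bool :=
  all (fun s => poly_eqb (scoef n F s) (scoef n G s)) (undup (unzip2 (F ++ G))).

Definition fscale (P : spoly) (F : sform) : sform :=
  flatten [seq sscale p F | p <- P].

(** Laplace expansion along the first row, with all minors normalised to keep them short. *)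
Fixpoint pdet (n : nat) (a : nat -> nat -> spoly) : spoly :=
  if n is n'.+1 then
    normal (flatten [seq pmul (if odd j then popp (a 0%N j) else a 0%N j)
      (pdet n' (fun i k => a i.+1 (bump j k))) | j <- iota 0 n])
  else pconst 1.

Variables (K : comNzRingType) (c : nat -> K).
Implicit Types (p q : monom) (F G : sform) (P Q : spoly).

Lemma eval_nil : eval c [::] = 0.
Proof. exact: big_nil. Qed.

Lemma eval_cat P Q : eval c (P ++ Q) = eval c P + eval c Q.
Proof. exact: big_cat. Qed.

Lemma eval_cons p P : eval c (p :: P) = ev c p + eval c P.
Proof. exact: big_cons. Qed.

Lemma eval_opp P : eval c (popp P) = - eval c P.
Proof.
elim: P => [|p P ih]; first by rewrite eval_nil oppr0.
by rewrite !eval_cons ih /ev /= mulrNz mulNr opprD.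
Qed.

Lemma eval_pconst z : eval c (pconst z) = z%:~R.
Proof. by rewrite eval_cons eval_nil addr0 ev_const. Qed.

Lemma eval_flatten (T : Type) (r : seq T) (f : T -> spoly) :
  eval c (flatten [seq f t | t <- r]) = \sum_(t <- r) eval c (f t).
Proof.
elim: r => [|t r ih] /=; first by rewrite big_nil eval_nil.
by rewrite eval_cat big_cons ih.
Qed.

Lemma eval_mul P Q : eval c (pmul P Q) = eval c P * eval c Q.
Proof.
rewrite eval_flatten /eval mulr_suml; apply: eq_bigr => p _.
by rewrite big_map mulr_sumr; apply: eq_bigr => q _; rewrite ev_mul.
Qed.

Lemma eval_collect p P : eval c (collect p P) = ev c p + eval c P.
Proof.
case: P => [|q P] /=; first by rewrite eval_cons.
case: eqP => [pq|_]; last by rewrite eval_cons.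
by rewrite !eval_cons addrA; congr (_ + _); rewrite /ev /= pq intrD mulrDl.
Qed.

Lemma eval_normal P : eval c (normal P) = eval c P.
Proof.
transitivity (eval c (foldr collect [::] (sort (fun p q => lexleq p.2 q.2)
    [seq (p.1, sort leq p.2) | p <- P]))).
  rewrite /eval big_filter big_mkcond; apply: eq_bigr => p _.
  by case: eqP => //= p0; rewrite /ev p0 mul0r.
transitivity (eval c [seq (p.1, sort leq p.2) | p <- P]).
  rewrite -[RHS](perm_big _ (introT permPl (perm_sort (fun p q => lexleq p.2 q.2) _))) /=.
  elim: (sort _ _) => [|p Q ih] /=; first by rewrite eval_nil big_nil.
  by rewrite eval_collect ih big_cons.
rewrite /eval big_map; apply: eq_bigr => p _; rewrite /ev /=; congr (_ * _).
by apply: perm_big; rewrite perm_sort.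
Qed.

Lemma eval_eqb P Q : poly_eqb P Q -> eval c P = eval c Q.
Proof.
move=> /nilP PQ; apply/eqP; rewrite -subr_eq0 -eval_opp -eval_cat.
by rewrite -eval_normal PQ eval_nil.
Qed.

(** The test runs through the index lists that occur; at any other index set both coefficients are
    zero. *)
Lemma denote_eqb n F G : form_eqb n F G -> denote c n F = denote c n G.
Proof.
move=> /allP FG; apply/ffunP => I.
have [/hasP[t tFG /eqP <-]|/hasPn nI] :=
  boolP (has (fun t => ord_set n t.2 == I) (F ++ G)).
  by rewrite -!eval_scoef; apply: eval_eqb; apply: FG; rewrite mem_undup map_f.
have zero H : {subset H <= F ++ G} -> denote c n H I = 0.
  move=> HFG; rewrite sum_ffunE big_seq big1 // => t /HFG /nI.
  by rewrite ffunZE basis_formE eq_sym => /negPf ->; rewrite mulr0.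
by rewrite !zero // => t tH; rewrite mem_cat tH ?orbT.
Qed.

Lemma denote_fscale n P F : denote c n (fscale P F) = eval c P *: denote c n F.
Proof.
rewrite denote_flatten /eval scaler_suml; apply: eq_bigr => p _.
exact: denote_sscale.
Qed.

Lemma eval_pdet n (a : nat -> nat -> spoly) :
  eval c (pdet n a) = \det (\matrix_(i < n, j < n) eval c (a i j)).
Proof.
elim: n a => [|n ih] a; first by rewrite det_mx00 eval_pconst.
rewrite eval_normal eval_flatten (expand_det_row _ ord0).
have -> : iota 0 n.+1 = index_iota 0 n.+1 by rewrite /index_iota subn0.
rewrite big_mkord; apply: eq_bigr => j _.
rewrite eval_mul ih mxE /cofactor add0n mulrCA mulrA; congr (_ * _).
  by rewrite -signr_odd; case: odd; rewrite ?eval_opp ?expr1 ?expr0 ?mulN1r ?mul1r.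
congr (\det _); apply/matrixP => i k; rewrite !mxE.
by congr (eval c (a _ _)).
Qed.

End PolynomialIdentities.

(** * Identities for the Spin(7)-structure *)

Section Spin7Lists.

(* The variable standing for the coefficient of e^i /\ e^j, i < j, in a 2-form;
   for omega the indices j >= 4 are those of the entries of df. *)
Definition entry (i j : nat) : nat := (8 * i + j)%N.

Definition smonomial (s : seq nat) : sform :=
  foldr (fun i => swedge 8 (scovec i)) sone s.

Local Notation e := smonomial.

Definition sphi : sform :=
  e [:: 1; 2; 3] ++ e [:: 1; 4; 5] ++ e [:: 1; 6; 7] ++ e [:: 2; 4; 6]
  ++ sopp (e [:: 2; 5; 7]) ++ sopp (e [:: 3; 4; 7]) ++ sopp (e [:: 3; 5; 6]).

Definition sstar7_phi : sform :=
  e [:: 4; 5; 6; 7] ++ e [:: 2; 3; 6; 7] ++ e [:: 2; 3; 4; 5]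
  ++ e [:: 1; 3; 5; 7] ++ sopp (e [:: 1; 3; 4; 6]) ++ sopp (e [:: 1; 2; 5; 6])
  ++ sopp (e [:: 1; 2; 4; 7]).

Definition sPhi : sform := swedge 8 (scovec 0) sphi ++ sstar7_phi.

(** For k = 1, ..., 7 an orthogonal basis of Lambda^2_7, the form attached to k being e^0 /\ e^k +
    i(e_k) phi. *)
Definition s27 (k : nat) : sform :=
  swedge 8 (scovec 0) (scovec k) ++ scontract 8 k sphi.

(** The generator of Lambda^4_7 attached to alpha = e^k. *)
Definition s47 (k : nat) : sform :=
  swedge 8 (scovec 0) (scontract 8 k sstar7_phi) ++ sopp (swedge 8 (scovec k) sphi).

(** The generic 2-form if m = n; for m = 4 and n = 8 it is omega, which has no dy^a /\ dy^b
    terms. *)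
Definition sform2 (m n : nat) : sform :=
  flatten [seq flatten [seq
    if (i < j)%N then sscale (1, [:: entry i j]) (swedge n (scovec i) (scovec j))
    else [::] | j <- iota 0 n] | i <- iota 0 m].

Definition somega_pow (k : nat) : sform := iter k (swedge 8 (sform2 4 8)) sone.

(* E_k and E'_k of the introduction. *)
Definition eq27 (k : nat) : spoly :=
  normal (pmul (pconst 6) (sinner 8 (sform2 4 8) (s27 k)) ++
          popp (sinner 8 (sstar 8 (somega_pow 3)) (s27 k))).

Definition eq47 (k : nat) : spoly := normal (sinner 8 (somega_pow 2) (s47 k)).

(** Entries of g = D^T D: the base directions give the identity, the fibre directions the products
    of derivatives of f. *)
Definition smetric (i j : nat) : spoly :=
  pconst (i == j)%:R ++ [seq (1, [:: entry i a; entry j a]) | a <- iota 4 4].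

(** Pullback of e^k by x |-> (x, f x): dx^k on the base, the differential of f^k on the fibre. *)
Definition sjacobian (k : nat) : sform :=
  if (k < 4)%N then scovec k
  else [seq ((1, [:: entry i k]), [:: i]) | i <- iota 0 4].

Definition sPhi_graph : spoly := normal (scoef 4 (spull 4 8 sjacobian sPhi) (iota 0 4)).

Definition sbeta : sform := sform2 4 4.

Definition smetric_row (k : nat) : sform :=
  flatten [seq [seq (p, [:: j]) | p <- smetric k j] | j <- iota 0 4].

(* pull g (star beta) + p beta *)
Definition sT : sform := spull 4 4 smetric_row (sstar 4 sbeta) ++ fscale sPhi_graph sbeta.

(* The 2-form whose coefficient on e^i /\ e^j is the partial derivative of [P]
   in the variable [entry i j], for [P] linear in the coefficients of beta. *)
Definition slinear (P : spoly) : sform :=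
  flatten [seq flatten [seq [seq ((p.1, rem (entry i j) p.2), [:: i; j])
                            | p <- P & entry i j \in p.2]
                      | j <- iota i.+1 (3 - i)] | i <- iota 0 4].

Definition ssum (r : seq nat) (f : nat -> sform) := flatten [seq f k | k <- r].
Definition psum (r : seq nat) (f : nat -> spoly) := flatten [seq f k | k <- r].

(** A quantitative form of the inequality p^2 <= det g: the defect is a positive combination of
    squares of polynomials in the entries of df. *)
Lemma cayley_polynomial_identity :
  poly_eqb (pmul (pconst 36) (pdet 4 smetric))
    (pmul (pconst 36) (pmul sPhi_graph sPhi_graph) ++
      (psum (iota 4 4) (fun k => pmul (eq27 k) (eq27 k)) ++
       pmul (pconst 9) (psum (iota 1 3) (fun k => pmul (eq47 k) (eq47 k))))).
Proof. by vm_compute. Qed.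

(** Write T for [sT]. The bilinear form behind the quadratic form <star beta, T> is symmetric, so
    its gradient in beta is 2 star T. This is therefore [asd_norm_identity] differentiated in beta
    and starred: half the gradient of E_k^2 is E_k times the coefficient form of E_k. *)
Lemma asd_form_identity :
  form_eqb 4 (fscale (pconst 36) sT)
    (ssum (iota 1 3) (fun k => fscale (eq27 k) (sstar 4 (slinear (eq27 k)))) ++
     fscale (pconst 9)
       (ssum (iota 4 4) (fun k => fscale (eq47 k) (sstar 4 (slinear (eq47 k)))))).
Proof. by vm_compute. Qed.

(** T = 0 makes the left side zero, and over the reals each square on the right then vanishes. *)
Lemma asd_norm_identity :
  poly_eqb (pmul (pconst 36) (sinner 4 (sstar 4 sbeta) sT))
    (psum (iota 1 3) (fun k => pmul (eq27 k) (eq27 k)) ++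
     pmul (pconst 9) (psum (iota 4 4) (fun k => pmul (eq47 k) (eq47 k)))).
Proof. by vm_compute. Qed.

(* alpha + star (Phi /\ alpha) is four times the projection of alpha. *)
Lemma projection_Lambda27 :
  form_eqb 8 (sform2 8 8 ++ sstar 8 (swedge 8 sPhi (sform2 8 8)))
    (ssum (iota 1 7) (fun k => fscale (sinner 8 (sform2 8 8) (s27 k)) (s27 k))).
Proof. by vm_compute. Qed.

Lemma s27_Lambda27 : all (fun k => form_eqb 8 (swedge 8 sPhi (s27 k))
  (fscale (pconst 3) (sstar 8 (s27 k)))) (iota 1 7).
Proof. by vm_compute. Qed.

Lemma s27_orthogonal : all (fun k => all (fun l =>
  poly_eqb (sinner 8 (s27 k) (s27 l)) (pconst (4 * (k == l)%:R))) (iota 1 7)) (iota 1 7).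
Proof. by vm_compute. Qed.

Lemma s47_orthogonal : all (fun k => all (fun l =>
  poly_eqb (sinner 8 (s47 k) (s47 l)) (pconst (8 * (k == l)%:R))) (iota 1 7)) (iota 1 7).
Proof. by vm_compute. Qed.

Lemma sstar_involutive m : m \in [:: 4; 8]%N ->
  form_eqb m (sstar m (sstar m (sform2 m m))) (sform2 m m).
Proof. by rewrite !inE => /orP[] /eqP ->; vm_compute. Qed.
End Spin7Lists.

(** * Two-forms *)

Section TwoForms.
Variables (n : nat) (K : comNzRingType).
Implicit Types (i j : 'I_n) (a b : eform n K) (c : nat -> K).

Lemma wedge_covec_self i : wedge (covec i) (covec i) = 0 :> eform n K.
Proof. by rewrite wedge_basis disjoints1 inE eqxx. Qed.

Lemma shuffle_sign_set1 i j : shuffle_sign K [set i] [set j] = (-1) ^+ (j < i)%N.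
Proof.
rewrite /shuffle_sign; congr (_ ^+ _); case: (ltnP j i) => ij.
  apply/eqP/cards1P; exists (i, j); apply/setP => -[k l]; rewrite !inE xpair_eqE /=.
  by apply/and3P/andP => [[]|[/eqP -> /eqP ->]].
apply: eq_card0 => -[k l]; rewrite !inE /=; apply/negP => /and3P[/eqP -> /eqP ->].
by rewrite ltnNge ij.
Qed.

Lemma wedge_covec_lt i j : (i < j)%N ->
  wedge (covec i) (covec j) = basis_form [set i; j]%SET :> eform n K.
Proof.
move=> ij; rewrite wedge_basis disjoints1 inE.
have -> : i == j = false by apply/negP => /eqP E; rewrite E ltnn in ij.
by rewrite shuffle_sign_set1 ltnNge ltnW // expr0 scale1r.
Qed.

Lemma wedge_covecC i j :
  wedge (covec i) (covec j) = - wedge (covec j) (covec i) :> eform n K.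
Proof.
rewrite !wedge_basis !disjoints1 !inE eq_sym; case: eqP => [_|/eqP ji] /=.
  by rewrite oppr0.
rewrite finset.setUC -scaleNr !shuffle_sign_set1; congr (_ *: _).
by case: ltngtP ji => [||/val_inj ->]; rewrite ?eqxx // expr1 expr0 ?opprK.
Qed.

(** A set of two elements is {x, y} for exactly one pair x < y, which turns the sum over sets into a
    sum over pairs. *)
Lemma two_form_expansion a : homogeneous 2 a ->
  a = \sum_(i < n) \sum_(j < n | (i < j)%N)
    (a [set i; j]%SET : K) *: @wedge n K (covec i) (covec j).
Proof.
move=> a2; apply/ffunP => I.
have ltE i j : (i < j)%N -> (i == j) = false.
  by move=> ij; apply/eqP => E; rewrite E ltnn in ij.
transitivity (\sum_(i < n) \sum_(j < n | (i < j)%N)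
    a [set i; j]%SET * (I == [set i; j]%SET)%:R); last first.
  rewrite sum_ffunE; apply: eq_bigr => i _; rewrite sum_ffunE; apply: eq_bigr => j ij.
  by rewrite ffunZE wedge_covec_lt // basis_formE.
have [/eqP I2|I2] := boolP (#|I| == 2%N); last first.
  rewrite a2 // big1 // => i _; rewrite big1 // => j ij.
  case: eqP => [IE|_]; last by rewrite mulr0.
  by rewrite IE cards2 ltE in I2.
have [x [y [xy ->]]] : exists x y : 'I_n, (x < y)%N /\ I = [set x; y]%SET.
  have /cards2P[x [y [xy IE]]] := introT eqP I2.
  case: (ltngtP x y) => [lt|lt|/val_inj E]; last by rewrite E eqxx in xy.
    by exists x, y.
  by exists y, x; rewrite finset.setUC.
rewrite (bigD1 x) //= (bigD1 y) //= eqxx mulr1 big1 ?addr0; last first.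
  move=> j /andP[xj jy]; case: eqP => [/setP/(_ y)|_]; last by rewrite mulr0.
  by rewrite !inE eqxx orbT !(eq_sym y) (negPf jy) ltE.
rewrite big1 ?addr0 // => i ix; rewrite big1 // => j ij.
case: eqP => [/setP E|_]; last by rewrite mulr0.
have := E x; rewrite !inE eqxx (eq_sym x i) (negPf ix) => /esym/eqP xj.
have := E y; rewrite !inE eqxx orbT -xj => /esym/orP[/eqP yi|/eqP yx].
  by rewrite -xj -yi ltnNge ltnW in ij.
by rewrite yx ltnn in xy.
Qed.

Lemma denote_sform2 c (m : nat) : (m <= n)%N ->
  denote c n (sform2 m n) = \sum_(i < n | (i < m)%N) \sum_(j < n | (i < j)%N)
    c (entry i j) *: wedge (covec i) (covec j).
Proof.
move=> mn; rewrite denote_flatten.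
have iotaE k : iota 0 k = index_iota 0 k by rewrite /index_iota subn0.
rewrite iotaE big_mkord (big_ord_widen n (fun k => denote c n (flatten
  [seq if (k < l)%N then sscale (1, [:: entry k l]) (swedge n (scovec k) (scovec l))
       else [::] | l <- iota 0 n])) mn).
apply: eq_bigr => i _; rewrite denote_flatten iotaE big_mkord [RHS]big_mkcond.
apply: eq_bigr => j _; case: ifP => _; last by rewrite /denote big_nil.
rewrite denote_sscale denote_swedge !denote_scovec /ev big_seq1.
by rewrite mul1r.
Qed.

(** Decodes [entry]: quotient and remainder by 8 give back the two indices as long as these are
    below 8. *)
Definition two_form_env a (k : nat) : K := a (ord_set n [:: k %/ 8; k %% 8]%N).

(** Every 2-form is a value of the generic one, so an identity checked on [sform2 n n] holds for all
    2-forms. *)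
Lemma two_form_envE a : (n <= 8)%N -> homogeneous 2 a ->
  a = denote (two_form_env a) n (sform2 n n).
Proof.
move=> n8 a2; rewrite {1}(two_form_expansion a2) denote_sform2 //.
under [RHS]eq_bigl => i do rewrite ltn_ord.
apply: eq_bigr => i _; apply: eq_bigr => j _; congr (_ *: _).
have j8 : (j < 8)%N := leq_trans (ltn_ord j) n8.
rewrite /two_form_env /entry mulnC divnMDl // divn_small // modnMDl modn_small //.
by rewrite addn0; congr (a _); apply/setP => k; rewrite !inE.
Qed.

End TwoForms.

Lemma flat_star_involutive n (K : comNzRingType) (a : eform n K) :
  n \in [:: 4; 8]%N -> homogeneous 2 a -> flat_star (flat_star a) = a.
Proof.
move=> n48 a2; have n8 : (n <= 8)%N by move: n48; rewrite !inE => /orP[] /eqP ->.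
rewrite (two_form_envE n8 a2) -!denote_sstar; apply: denote_eqb.
exact: sstar_involutive.
Qed.

Section Spin7.
Variables (R : realType).
Implicit Types (c : nat -> R) (a b : eform 8 R).

Lemma denote_monomial c (s : seq nat) : all (fun i => (i < 8)%N) s ->
  denote c 8 (smonomial s) = monomial R s.
Proof.
move=> s8; rewrite denote_foldr_swedge /monomial !big_seq.
elim/big_ind2: _ => // [a1 a2 b1 b2 -> -> //|i /(allP s8) i8].
by rewrite -{1}(inordK i8) denote_scovec.
Qed.

Lemma denote_sphi c : denote c 8 sphi = phi R.
Proof.
rewrite !(@denote_cat _ _ _ (smonomial _)) !(@denote_cat _ _ _ (sopp _)).
by rewrite !denote_sopp !denote_monomial // /phi !addrA.
Qed.

Lemma denote_sstar7_phi c : denote c 8 sstar7_phi = star7_phi R.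
Proof.
rewrite !(@denote_cat _ _ _ (smonomial _)) !(@denote_cat _ _ _ (sopp _)).
by rewrite !denote_sopp !denote_monomial // /star7_phi !addrA.
Qed.

Lemma denote_sPhi c : denote c 8 sPhi = Phi R.
Proof.
rewrite denote_cat denote_swedge denote_sphi denote_sstar7_phi.
by rewrite (denote_scovec c (0 : 'I_8)).
Qed.

Definition form27 (k : 'I_8) : eform 8 R :=
  wedge (covec 0) (covec k) + Defs.contract (\row_j (j == k)%:R) (phi R).

Lemma denote_s27 c (k : 'I_8) : denote c 8 (s27 k) = form27 k.
Proof.
rewrite denote_cat denote_swedge denote_scontract denote_sphi.
by rewrite (denote_scovec c (0 : 'I_8)) denote_scovec.
Qed.

Lemma denote_s47 c (k : 'I_8) : denote c 8 (s47 k) = lambda4 (covec k).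
Proof.
rewrite denote_cat denote_sopp !denote_swedge denote_scontract denote_sphi.
rewrite denote_sstar7_phi (denote_scovec c (0 : 'I_8)) denote_scovec /lambda4.
congr (wedge _ (Defs.contract _ _) - _).
by apply/rowP => j; rewrite !mxE basis_formE (inj_eq finset.set1_inj).
Qed.

Lemma inner_denote c F G : inner 1%:M (denote c 8 F) (denote c 8 G) = eval c (sinner 8 F G).
Proof. by rewrite inner1E eval_sinner. Qed.

Lemma lambda4_sum (x : 'I_7 -> R) :
  lambda4 (\sum_j x j *: covec (lift ord0 j)) =
  \sum_j x j *: lambda4 (covec (lift ord0 j)).
Proof.
have lam0 : lambda4 (0 : eform 8 R) = 0.
  rewrite /lambda4 wedge0l subr0 (_ : sharp 0 = 0 *: sharp 0).
    by rewrite contractZl scale0r wedge0r.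
  by rewrite scale0r; apply/rowP => i; rewrite !mxE ffunE.
have lamD a b : lambda4 (a + b) = lambda4 a + lambda4 b.
  rewrite /lambda4 (_ : sharp (a + b) = sharp a + sharp b).
    by rewrite contractDl wedgeDr wedgeDl opprD addrACA.
  by apply/rowP => i; rewrite !mxE ffunE.
have lamZ z a : lambda4 (z *: a) = z *: lambda4 a.
  rewrite /lambda4 (_ : sharp (z *: a) = z *: sharp a).
    by rewrite contractZl wedgeZr wedgeZl scalerBr.
  by apply/rowP => i; rewrite !mxE ffunZE.
by elim/big_rec2: _ => [|j y z _ <-]; rewrite ?lam0 // lamD lamZ.
Qed.

End Spin7.

(** * Vanishing of the two projections in terms of explicit bases *)

Section Projections.
Variables (R : realType).
Implicit Types (c : nat -> R) (a b : eform 8 R).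

Lemma card_ord_set n (s : seq nat) : #|ord_set n s| = count [in s] (iota 0 n).
Proof.
have -> : iota 0 n = index_iota 0 n by rewrite /index_iota subn0.
rewrite -sum1_card -sum1_count big_mkord.
by apply: eq_bigl => i; rewrite inE.
Qed.

Lemma homogeneous_denote n c (k : nat) (F : sform) :
  all (fun t => count [in t.2] (iota 0 n) == k) F -> homogeneous k (denote c n F).
Proof.
move=> /allP Fk I Ik; rewrite sum_ffunE big_seq big1 // => t /Fk /eqP tk.
rewrite ffunZE basis_formE; case: eqP => [IE|_]; last by rewrite mulr0.
by rewrite IE card_ord_set tk eqxx in Ik.
Qed.

Lemma homogeneousD n (K : comNzRingType) (k : nat) (a b : eform n K) :
  homogeneous k a -> homogeneous k b -> homogeneous k (a + b).
Proof. by move=> ak bk I Ik; rewrite ffunE ak ?bk ?addr0. Qed.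

Lemma homogeneousZ n (K : comNzRingType) (k : nat) (x : K) (a : eform n K) :
  homogeneous k a -> homogeneous k (x *: a).
Proof. by move=> ak I Ik; rewrite ffunZE ak ?mulr0. Qed.

Lemma homogeneous_sum n (K : comNzRingType) (k : nat) (T : Type) (r : seq T)
    (P : pred T) (F : T -> eform n K) :
  (forall t, P t -> homogeneous k (F t)) -> homogeneous k (\sum_(t <- r | P t) F t).
Proof.
move=> Fk; elim/big_ind: _ => [I _|a b|t]; [by rewrite ffunE| |exact: Fk].
exact: homogeneousD.
Qed.

Lemma big_iota1 (U : nmodType) n (F : nat -> U) :
  \sum_(k <- iota 1 n) F k = \sum_(j < n) F (lift ord0 j).
Proof.
have -> : iota 1 n = [seq j.+1 | j <- index_iota 0 n].
  by rewrite /index_iota subn0 -[1%N]addn0 iotaDl; apply: eq_map => j; rewrite add1n.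
by rewrite big_map big_mkord; apply: eq_bigr => j _; rewrite lift0.
Qed.

Lemma lift0_iota n (k : 'I_n) : (lift ord0 k : nat) \in iota 1 n.
Proof. by rewrite lift0 mem_iota ltn0Sn add1n ltnS ltn_ord. Qed.

(** Passes between the labels 1, ..., n of the equations and ['I_n], shifted by one through
    [lift ord0]. *)
Lemma in_iota1 n (P : nat -> Prop) :
  {in iota 1 n, forall k, P k} <-> forall k : 'I_n, P (lift ord0 k).
Proof.
split=> [Pk k|Pk k]; first exact/Pk/lift0_iota.
rewrite mem_iota add1n ltnS => /andP[k0 kn].
have kn' : (k.-1 < n)%N by rewrite prednK.
by have := Pk (Ordinal kn'); rewrite lift0 /= prednK.
Qed.

Lemma form27_homogeneous (k : 'I_7) : homogeneous 2 (form27 R (lift ord0 k)).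
Proof.
rewrite -(denote_s27 (fun=> 0 : R)) lift0; apply: homogeneous_denote.
by case: k; do 7?[case=> //].
Qed.

(** If Phi /\ a = 3 star a, then a + star (Phi /\ a) = 4 a because the star is an involution on
    2-forms, so [projection_Lambda27] expands a in the basis. The other inclusion is
    [s27_Lambda27]. *)
Lemma Lambda27E a :
  Lambda27 a <-> exists x : 'I_7 -> R, a = \sum_k x k *: form27 R (lift ord0 k).
Proof.
split=> [[a2 Phia]|[x ->]].
  pose c := two_form_env a.
  have aE : a = denote c 8 (sform2 8 8) := two_form_envE (leqnn _) a2.
  have := denote_eqb c projection_Lambda27.
  rewrite denote_cat denote_sstar denote_swedge denote_sPhi -aE Phia /star8 hodge1.
  rewrite flat_starZ flat_star_involutive // -{1}[a]scale1r -scalerDl denote_flatten.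
  rewrite big_iota1; under eq_bigr => k _ do rewrite denote_fscale denote_s27.
  move=> aS; exists (fun k => 4^-1 * eval c (sinner 8 (sform2 8 8) (s27 (lift (@ord0 7) k)))).
  rewrite (_ : a = 4^-1 *: ((1 + 3) *: a)); last first.
    by rewrite scalerA (_ : _ * _ = 1) ?scale1r //; field.
  by rewrite aS scaler_sumr; apply: eq_bigr => k _; rewrite scalerA.
split.
  by apply: homogeneous_sum => k _; apply: homogeneousZ; exact: form27_homogeneous.
rewrite /star8 hodge1 flat_star_sum wedge_sumr scaler_sumr; apply: eq_bigr => k _.
rewrite flat_starZ wedgeZr [RHS]scalerA mulrC -scalerA; congr (_ *: _).
have /allP/(_ _ (lift0_iota k))/(denote_eqb (fun=> 0 : R)) := s27_Lambda27.
rewrite denote_swedge denote_fscale eval_pconst denote_sstar denote_sPhi.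
by rewrite denote_s27.
Qed.

Lemma orth_proj_Lambda27_eq0 a :
  orth_proj (@Lambda27 R) a = 0 <->
  forall k : 'I_7, inner 1%:M a (form27 R (lift ord0 k)) = 0.
Proof.
apply: orth_proj_eq0 => [b|k l]; first exact: Lambda27E.
rewrite -!(denote_s27 (fun=> 0 : R)) inner_denote.
have /allP/(_ _ (lift0_iota k))/allP/(_ _ (lift0_iota l)) := s27_orthogonal.
move=> /(eval_eqb (fun=> 0 : R)) ->; rewrite eval_pconst !lift0 eqSS.
split=> [|->]; last by rewrite eqxx mulr1 intr_eq0.
by case: (k =P l :> nat) => [/val_inj -> //|_]; rewrite mulr0 eqxx.
Qed.

Lemma orth_proj_Lambda47_eq0 a :
  orth_proj (@Lambda47 R) a = 0 <->
  forall k : 'I_7, inner 1%:M a (lambda4 (covec (lift ord0 k))) = 0.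
Proof.
apply: orth_proj_eq0 => [b|k l].
  by split=> -[x ->]; exists x; rewrite lambda4_sum.
rewrite -!(denote_s47 (fun=> 0 : R)) inner_denote.
have /allP/(_ _ (lift0_iota k))/allP/(_ _ (lift0_iota l)) := s47_orthogonal.
move=> /(eval_eqb (fun=> 0 : R)) ->; rewrite eval_pconst !lift0 eqSS.
split=> [|->]; last by rewrite eqxx mulr1 intr_eq0.
by case: (k =P l :> nat) => [/val_inj -> //|_]; rewrite mulr0 eqxx.
Qed.

End Projections.

(** * Complex-linear extension of real operators *)

Section Complexification.
Variables (n : nat) (R : realType).
Implicit Types (a b : eform n R) (L : eform n R -> eform n R).

Lemma complexifyD a b : complexify (a + b) = complexify a + complexify b.
Proof. by apply/ffunP => I; rewrite !ffunE rmorphD. Qed.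

Lemma complexifyZ (x : R) a : complexify (x *: a) = x%:C *: complexify a.
Proof. by apply/ffunP => I; rewrite ffunZE !ffunE -rmorphM. Qed.

Lemma complexify0 : complexify (0 : eform n R) = 0.
Proof. by apply/ffunP => I; rewrite !ffunE. Qed.

Lemma complexifyN a : complexify (- a) = - complexify a.
Proof. by apply/ffunP => I; rewrite !ffunE rmorphN. Qed.

Lemma complexify_sum (T : Type) (r : seq T) (P : pred T) (F : T -> eform n R) :
  complexify (\sum_(t <- r | P t) F t) = \sum_(t <- r | P t) complexify (F t).
Proof.
by elim/big_rec2: _ => [|t y z _ <-]; rewrite ?complexify0 // complexifyD.
Qed.

Lemma complexify_basis I : complexify (basis_form I : eform n R) = basis_form I.
Proof. by apply/ffunP => J; rewrite !ffunE rmorph_nat. Qed.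

Lemma complexify_wedge a b : complexify (wedge a b) = wedge (complexify a) (complexify b).
Proof.
apply/ffunP => I; rewrite !ffunE rmorph_sum; apply: eq_bigr => J _.
by rewrite !ffunE !rmorphM rmorphXn rmorphN1.
Qed.

Lemma complexify_eq0 a : complexify a = 0 <-> a = 0.
Proof.
split=> [/ffunP a0|->]; last exact: complexify0.
by apply/ffunP => I; have := a0 I; rewrite !ffunE => -[].
Qed.

Lemma scalei_complexify_eq0 a : 'i%C *: complexify a = 0 <-> a = 0.
Proof.
rewrite -complexify_eq0; split=> [|->]; last exact: scaler0.
move=> /(congr1 ( *:%R (- 'i%C))).
by rewrite scalerA mulNr -expr2 sqr_i opprK scale1r scaler0.
Qed.

Lemma re_complexify a : re_form (complexify a) = a.
Proof. by apply/ffunP => I; rewrite !ffunE. Qed.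

Lemma im_complexify a : im_form (complexify a) = 0.
Proof. by apply/ffunP => I; rewrite !ffunE. Qed.

Lemma re_scalei a : re_form ('i%C *: complexify a) = 0.
Proof. by apply/ffunP => I; rewrite ffunE ffunZE !ffunE /= mul0r mul1r subr0. Qed.

Lemma im_scalei a : im_form ('i%C *: complexify a) = a.
Proof. by apply/ffunP => I; rewrite ffunE ffunZE !ffunE /= mul0r mul1r add0r. Qed.

Lemma clin_complexify L a : L 0 = 0 -> clin L (complexify a) = complexify (L a).
Proof.
by move=> L0; rewrite /clin re_complexify im_complexify L0 complexify0 scaler0 addr0.
Qed.

Lemma clin_scalei L a : L 0 = 0 ->
  clin L ('i%C *: complexify a) = 'i%C *: complexify (L a).
Proof. by move=> L0; rewrite /clin re_scalei im_scalei L0 complexify0 add0r. Qed.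

Lemma wedge_pow_scale (K : comNzRingType) (x : K) (a : eform n K) k :
  wedge_pow (x *: a) k = x ^+ k *: wedge_pow a k.
Proof.
elim: k => [|k ih]; first by rewrite expr0 scale1r.
by rewrite /wedge_pow /= -/(wedge_pow _ _) ih wedgeZl wedgeZr scalerA exprS.
Qed.

Lemma complexify_wedge_pow a k : complexify (wedge_pow a k) = wedge_pow (complexify a) k.
Proof.
elim: k => [|k ih]; first exact: complexify_basis.
by rewrite /wedge_pow /= complexify_wedge -/(wedge_pow _ _) ih.
Qed.

End Complexification.

(** * Pullback of 2-forms *)

Section PullTwoForms.
Variables (R : realType).

Lemma wedge1r n (K : comNzRingType) (a : eform n K) : wedge a (basis_form finset.set0) = a.
Proof.
rewrite [RHS]basis_form_sum {1}[a]basis_form_sum wedge_suml; apply: eq_bigr => I _.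
rewrite wedgeZl wedge_basis -finset.setI_eq0 finset.setI0 eqxx finset.setU0.
rewrite /shuffle_sign (_ : #|_| = 0%N) ?expr0 ?scale1r //.
by apply: eq_card0 => -[i j]; rewrite !inE andbF.
Qed.

Definition covector n (x : 'rV[R]_n) : eform n R := \sum_j x 0 j *: covec j.

Lemma wedge_covectorE n (x y : 'rV[R]_n) :
  wedge (covector x) (covector y) =
  \sum_i \sum_j (x 0 i * y 0 j) *: @wedge n R (covec i) (covec j).
Proof.
rewrite wedge_suml; apply: eq_bigr => i _; rewrite wedgeZl wedge_sumr scaler_sumr.
by apply: eq_bigr => j _; rewrite wedgeZr scalerA.
Qed.

Lemma wedge_covectorC n (x y : 'rV[R]_n) :
  wedge (covector x) (covector y) = - wedge (covector y) (covector x).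
Proof.
rewrite !wedge_covectorE exchange_big -sumrN; apply: eq_bigr => i _ /=.
by rewrite -sumrN; apply: eq_bigr => j _; rewrite wedge_covecC scalerN mulrC.
Qed.

Lemma wedge_covector_self n (x : 'rV[R]_n) : wedge (covector x) (covector x) = 0.
Proof.
apply/ffunP => I; have /ffunP/(_ I) := wedge_covectorC x x; rewrite !ffunE => /eqP.
by rewrite -addr_eq0 -mulr2n mulrn_eq0 => /eqP.
Qed.

Variables (n m : nat) (M : 'M[R]_(n, m)).

Lemma pull_wedge_covec (i j : 'I_n) :
  pull M (wedge (covec i) (covec j)) = wedge (covector (row i M)) (covector (row j M)).
Proof.
have rowE k : covector (row k M) = \sum_l M k l *: covec l.
  by apply: eq_bigr => l _; rewrite mxE.
(* Both sides change sign when i and j are exchanged, while [pull] is defined through increasing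
   products. *)
wlog ij : i j / (i < j)%N => [th|].
  case: (ltngtP i j) => [|ji|/val_inj ->]; first exact: th.
    by rewrite wedge_covecC -scaleN1r pullZ th // scaleN1r [RHS]wedge_covectorC.
  by rewrite wedge_covec_self wedge_covector_self pull0.
rewrite wedge_covec_lt // pull_basis -big_filter.
rewrite (_ : [seq k <- _ | _] = [:: i; j]); last first.
  (* Two strictly increasing lists with the same members coincide. *)
  apply: (inj_map val_inj); apply: (irr_sorted_eq ltn_trans ltnn).
  - apply: (@subseq_sorted _ ltn ltn_trans _ [seq val k | k <- enum 'I_n]).
      by rewrite enumT; apply: map_subseq (filter_subseq _ _).
    by rewrite val_enum_ord iota_ltn_sorted.
  - by rewrite /= ij.
  move=> k; rewrite !inE; apply/mapP/idP => [[l]|].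
    by rewrite mem_filter !inE => /andP[/orP[/eqP ->|/eqP ->] _ ->]; rewrite eqxx ?orbT.
  case/orP => /eqP ->; [exists i|exists j] => //;
    by rewrite mem_filter !inE eqxx ?orbT mem_index_enum.
by rewrite 2!big_cons big_nil wedge1r !rowE.
Qed.

Lemma pull_wedge_covector (x y : 'rV[R]_n) :
  pull M (wedge (covector x) (covector y)) =
  wedge (covector (x *m M)) (covector (y *m M)).
Proof.
have mulE (z : 'rV[R]_n) : covector (z *m M) = \sum_i z 0 i *: covector (row i M).
  rewrite /covector; under [RHS]eq_bigr => i _ do rewrite scaler_sumr.
  rewrite exchange_big; apply: eq_bigr => j _ /=.
  by rewrite mxE scaler_suml; apply: eq_bigr => i _; rewrite mxE scalerA.
rewrite wedge_covectorE pull_sum !mulE wedge_suml; apply: eq_bigr => i _.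
rewrite pull_sum wedgeZl wedge_sumr scaler_sumr; apply: eq_bigr => j _.
by rewrite pullZ pull_wedge_covec wedgeZr scalerA.
Qed.

Lemma pull_two_form (a : eform n R) : homogeneous 2 a ->
  pull M a = \sum_(i < n) \sum_(j < n | (i < j)%N)
    (a [set i; j]%SET : R) *: wedge (covector (row i M)) (covector (row j M)).
Proof.
move=> a2; rewrite [in LHS](two_form_expansion a2) pull_sum; apply: eq_bigr => i _.
rewrite pull_sum; apply: eq_bigr => j _.
by rewrite pullZ pull_wedge_covec.
Qed.

End PullTwoForms.

Section PullComposition.
Variables (R : realType) (n m l : nat).

(** By linearity a product of two covectors suffices, and there a pullback multiplies the two row
    vectors by the matrix. *)
Lemma pull_comp2 (M : 'M[R]_(n, m)) (N : 'M[R]_(m, l)) (a : eform n R) :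
  homogeneous 2 a -> pull N (pull M a) = pull (M *m N) a.
Proof.
move=> a2; rewrite (pull_two_form M a2) (pull_two_form (M *m N) a2) pull_sum.
apply: eq_bigr => i _.
rewrite pull_sum; apply: eq_bigr => j _.
by rewrite pullZ pull_wedge_covector !row_mul.
Qed.

Lemma pull_homogeneous2 (M : 'M[R]_(n, m)) (a : eform n R) :
  homogeneous 2 a -> homogeneous 2 (pull M a).
Proof.
move=> a2; rewrite pull_two_form //; apply: homogeneous_sum => i _.
apply: homogeneous_sum => j _; apply: homogeneousZ.
rewrite wedge_covectorE; apply: homogeneous_sum => k _; apply: homogeneous_sum => k' _.
apply: homogeneousZ; rewrite wedge_basis; case: ifP => [kk'|_ I _]; last by rewrite ffunE.
apply: homogeneousZ => I; rewrite basis_formE; case: (I =P _) => [->|//].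
by move: kk'; rewrite disjoints1 => kk'; rewrite cardsU1 cards1 kk'.
Qed.

End PullComposition.

(** * Anti-self-duality without the inverse metric *)

Section AntiSelfDual.
Variables (R : realType) (g : 'M[R]_4).

Lemma flat_star_homogeneous2 (a : eform 4 R) : homogeneous 2 a -> homogeneous 2 (flat_star a).
Proof.
move=> a2; rewrite (two_form_envE (isT : 4 <= 8)%N a2) -denote_sstar.
by apply: homogeneous_denote.
Qed.

(** The flat star is an involution on 2-forms and [pull g] inverts the pullback by [invmx g];
    applying both leaves an equation that is polynomial in [g] apart from the volume factor. *)
Lemma hodge_anti_self_dualE (o : bool) (a : eform 4 R) :
  g \in unitmx -> homogeneous 2 a ->
  hodge g o a = - a <->
  pull g (flat_star a) + ((-1) ^+ o * Num.sqrt (\det g)) *: a = 0.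
Proof.
move=> gU a2; set v := _ * Num.sqrt _; rewrite hodgeE -/v.
have sa2 := flat_star_homogeneous2 a2; have ia2 := pull_homogeneous2 (invmx g) a2.
split=> [asd|/eqP].
  have : v *: pull (invmx g) a = - flat_star a.
    by rewrite -[RHS]scaleN1r -flat_starZ scaleN1r -asd flat_starZ flat_star_involutive.
  move/(congr1 (pull g)); rewrite pullZ pull_comp2 // mulVmx // pull1 => ->.
  by rewrite -scaleN1r pullZ scaleN1r subrr.
rewrite addr_eq0 -scaleNr => /eqP/(congr1 (pull (invmx g))).
rewrite pullZ pull_comp2 // mulmxV // pull1 => /(congr1 (@flat_star R 4)).
by rewrite flat_starZ flat_star_involutive // scaleNr => aE; rewrite {2}aE opprK.
Qed.

End AntiSelfDual.

(** * The equations at a point *)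

Section Pointwise.
Variables (R : realType) (c : nat -> R).

Definition graph_metric : 'M[R]_4 := \matrix_(i, j) eval c (smetric i j).

Let g := graph_metric.
Let p := eval c sPhi_graph.
Let beta := denote c 4 sbeta.

Definition fibre_jacobian : 'M[R]_4 := \matrix_(i, a) c (entry i (4 + a)).

Lemma graph_metricE : g = 1%:M + fibre_jacobian *m fibre_jacobian^T.
Proof.
apply/matrixP => i j; rewrite !mxE eval_cat eval_pconst; congr (_ + _).
  by rewrite -val_eqE; case: (val i == val j).
have -> : iota 4 4 = [seq (4 + a)%N | a <- index_iota 0 4] by [].
rewrite /eval !big_map big_mkord; apply: eq_bigr => a _.
by rewrite !mxE /ev big_cons big_seq1 mul1r.
Qed.

(** The kernel of g is trivial since v g v^T = |v|^2 + |v J|^2 with J = [fibre_jacobian]. *)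
Lemma graph_metric_unit : g \in unitmx.
Proof.
have normE n (u : 'rV[R]_n) : (u *m u^T) 0 0 = \sum_i u 0 i ^+ 2.
  by rewrite mxE; apply: eq_bigr => i _; rewrite mxE.
have norm_ge0 n (u : 'rV[R]_n) : 0 <= (u *m u^T) 0 0.
  by rewrite normE; apply: sumr_ge0 => i _; exact: sqr_ge0.
rewrite unitmxE unitfE; apply/negP => /det0P[v v0 vg].
set u := v *m fibre_jacobian.
have /eqP : (v *m v^T) 0 0 + (u *m u^T) 0 0 = 0.
  have <- : (v *m g *m v^T) 0 0 = 0 by rewrite vg mul0mx mxE.
  by rewrite graph_metricE mulmxDr mulmx1 mulmxDl [RHS]mxE /u trmx_mul !mulmxA.
rewrite paddr_eq0 // => /andP[/eqP + _]; rewrite normE => /psumr_eq0P vv.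
case/eqP: v0; apply/rowP => i; apply/eqP; rewrite mxE -sqrf_eq0 vv // => j _.
exact: sqr_ge0.
Qed.

Lemma denote_sT : denote c 4 sT = pull g (flat_star beta) + p *: beta.
Proof.
rewrite denote_cat denote_fscale -denote_sstar.
rewrite (denote_spull (M := g)) // => i; rewrite denote_flatten.
have -> : iota 0 4 = index_iota 0 4 by [].
rewrite big_mkord; apply: eq_bigr => j _; rewrite mxE /denote big_map.
by rewrite /eval scaler_suml; apply: eq_bigr => t _; rewrite ord_set1.
Qed.

Lemma sum_sqr_eq0 (r : seq nat) (F : nat -> R) :
  \sum_(k <- r) F k ^+ 2 = 0 <-> {in r, forall k, F k = 0}.
Proof.
split=> [/eqP|F0].
  rewrite psumr_eq0 => [/allP F0 k kr|k _]; last exact: sqr_ge0.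
  by have := F0 k kr; rewrite sqrf_eq0 => /eqP.
by rewrite big_seq big1 // => k kr; rewrite F0 // expr0n.
Qed.

Lemma eval_psum (r : seq nat) (f : nat -> spoly) :
  eval c (psum r (fun k => pmul (f k) (f k))) = \sum_(k <- r) eval c (f k) ^+ 2.
Proof. by rewrite eval_flatten; apply: eq_bigr => k _; rewrite eval_mul. Qed.

Lemma asd_equations :
  pull g (flat_star beta) + p *: beta = 0 <->
  {in iota 1 3, forall k, eval c (eq27 k) = 0} /\ {in iota 4 4, forall k, eval c (eq47 k) = 0}.
Proof.
rewrite -denote_sT; split=> [T0|[X0 Y0]].
  (* With T = 0 the norm identity leaves a vanishing sum of squares. *)
  have := eval_eqb c asd_norm_identity.
  rewrite [LHS]eval_mul [RHS]eval_cat [X in _ = _ + X]eval_mul [X in X * _]eval_pconst.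
  rewrite [X in _ = X + _]eval_psum [X in _ + _ * X]eval_psum [X in _ + X * _]eval_pconst.
  rewrite [X in _ * X = _]eval_sinner T0 big1 => [|I _]; last by rewrite ffunE mulr0.
  move=> /esym/eqP; rewrite mulr0 paddr_eq0 ?mulr_ge0 ?sumr_ge0 // => [|*|*];
    try exact: sqr_ge0.
  rewrite mulf_eq0 intr_eq0 /= => /andP[/eqP XX /eqP YY].
  by split; apply/sum_sqr_eq0.
(* Conversely, 36 T is a combination of the equations, all of which hold here. *)
have := denote_eqb c asd_form_identity.
rewrite [LHS]denote_fscale [RHS]denote_cat [X in _ = _ + X]denote_fscale.
rewrite [X in X *: _ = _]eval_pconst [X in _ = X + _]denote_flatten.
rewrite [X in _ = _ + _ *: X]denote_flatten.
rewrite big_seq big1 => [|k kr]; last by rewrite (denote_fscale c 4 (eq27 k)) X0 // scale0r.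
rewrite [X in _ + _ *: X]big_seq [X in _ + _ *: X]big1 => [|k kr]; last first.
  by rewrite (denote_fscale c 4 (eq47 k)) Y0 // scale0r.
by rewrite scaler0 addr0 => /eqP; rewrite scaler_eq0 intr_eq0 => /eqP.
Qed.

Lemma cayley_identity : 36 * \det g = 36 * p ^+ 2 +
  (\sum_(k <- iota 4 4) eval c (eq27 k) ^+ 2 + 9 * \sum_(k <- iota 1 3) eval c (eq47 k) ^+ 2).
Proof.
rewrite /g /p; have E := eval_eqb c cayley_polynomial_identity.
rewrite [LHS]eval_mul [RHS]eval_cat in E.
rewrite [X in _ = _ + X]eval_cat in E.
rewrite [X in _ = X + _]eval_mul in E.
rewrite [X in _ = _ * X + _]eval_mul in E.
rewrite -(expr2 (eval c sPhi_graph)) in E.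
rewrite [X in _ = _ + (_ + X)]eval_mul in E.
rewrite [X in _ = _ + (X + _)]eval_psum in E.
rewrite [X in _ = _ + (_ + _ * X)]eval_psum in E.
rewrite [X in _ = _ + (_ + X * _)]eval_pconst in E.
rewrite [X in X * _ = _]eval_pconst in E.
rewrite [X in _ = X * _ + _]eval_pconst in E.
rewrite [X in _ * X = _]eval_pdet in E.
exact: E.
Qed.

(** The right side of [cayley_identity] is a positive combination of squares. *)
Lemma graph_metric_det_ge0 : 0 <= \det g.
Proof.
have sum_ge0 r (F : nat -> R) : 0 <= \sum_(k <- r) F k ^+ 2.
  by apply: sumr_ge0 => k _; exact: sqr_ge0.
have : 0 <= 36 * \det g.
  rewrite cayley_identity; apply: addr_ge0; first exact: mulr_ge0 (ler0n _ _) (sqr_ge0 _).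
  by apply: addr_ge0; last exact: mulr_ge0 (ler0n _ _) (sum_ge0 _ _).
by rewrite pmulr_rge0.
Qed.

(** p^2 = det g says that the defect in [cayley_identity] vanishes, that is, each of its squares
    does. *)
Lemma cayley_equations :
  p ^+ 2 = \det g <->
  {in iota 4 4, forall k, eval c (eq27 k) = 0} /\ {in iota 1 3, forall k, eval c (eq47 k) = 0}.
Proof.
have detE := cayley_identity.
split=> [pg|[/sum_sqr_eq0 X0 /sum_sqr_eq0 Y0]]; last first.
  by apply: (mulfI (_ : 36 != 0 :> R)); rewrite ?pnatr_eq0 // detE X0 Y0 mulr0 !addr0.
have /eqP : \sum_(k <- iota 4 4) eval c (eq27 k) ^+ 2 +
    9 * \sum_(k <- iota 1 3) eval c (eq47 k) ^+ 2 = 0.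
  by move: detE; rewrite -pg -[LHS]addr0 => /addrI.
rewrite paddr_eq0 ?mulr_ge0 ?sumr_ge0 // => [|*|*]; try exact: sqr_ge0.
rewrite mulf_eq0 pnatr_eq0 /= => /andP[/eqP XX /eqP YY].
by split; apply/sum_sqr_eq0.
Qed.

End Pointwise.

(** Phi has degree 4, so its pullback to R^4 is a multiple of the top form. *)
Lemma pull_Phi_identity :
  form_eqb 4 (spull 4 8 sjacobian sPhi) (fscale sPhi_graph [:: ((1, [::]), iota 0 4)]).
Proof. by vm_compute. Qed.

(** * The fourteen equations and the two projections *)

Section Equations.
Variables (R : realType) (c : nat -> R).

Definition graph_equations : Prop :=
  {in iota 1 7, forall k, eval c (eq27 k) = 0} /\ {in iota 1 7, forall k, eval c (eq47 k) = 0}.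

(** The equations are regrouped crosswise: E_4, ..., E_7 with E'_1, E'_2, E'_3 for the Cayley
    condition, the other seven for anti-self-duality. *)
Lemma graph_equationsE : graph_equations <->
  eval c sPhi_graph ^+ 2 = \det (graph_metric c) /\
  pull (graph_metric c) (flat_star (denote c 4 sbeta))
    + eval c sPhi_graph *: denote c 4 sbeta = 0.
Proof.
rewrite cayley_equations asd_equations.
have split7 (F : nat -> R) : {in iota 1 7, forall k, F k = 0} <->
    {in iota 1 3, forall k, F k = 0} /\ {in iota 4 4, forall k, F k = 0}.
  rewrite -[iota 1 7]/(iota 1 3 ++ iota 4 4).
  split=> [F0|[F1 F2] k]; first by split=> k kr; rewrite F0 // mem_cat kr ?orbT.
  by rewrite mem_cat => /orP[/F1|/F2].
by rewrite /graph_equations !split7; tauto.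
Qed.

Lemma denote_somega_pow k :
  denote c 8 (somega_pow k) = wedge_pow (denote c 8 (sform2 4 8)) k.
Proof. by elim: k => [|k ih]; rewrite ?denote_sone // denote_swedge ih. Qed.

(** The minus sign is that of (i omega)^3 = -i omega^3, and E_k carries the factor 6 that clears the
    denominator. *)
Lemma pi27_equations :
  pi27 ('i%C *: complexify (denote c 8 (sform2 4 8) -
    6^-1 *: star8 (wedge_pow (denote c 8 (sform2 4 8)) 3))) = 0 <->
  {in iota 1 7, forall k, eval c (eq27 k) = 0}.
Proof.
rewrite /pi27 clin_scalei; last first.
  by apply/orth_proj_Lambda27_eq0 => k; rewrite -(scale0r 0) inner1Z mul0r.
rewrite scalei_complexify_eq0 orth_proj_Lambda27_eq0 in_iota1.
suff XE (k : 'I_7) : eval c (eq27 (lift (@ord0 7) k)) = 6 * inner 1%:M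
    (denote c 8 (sform2 4 8) - 6^-1 *: star8 (wedge_pow (denote c 8 (sform2 4 8)) 3))
    (form27 R (lift ord0 k)).
  split=> X0 k; first by rewrite XE X0 mulr0.
  by apply: (mulfI (_ : 6 != 0 :> R)); rewrite ?pnatr_eq0 // -XE X0 mulr0.
rewrite inner1D -(scaleN1r (6^-1 *: _)) !inner1Z mulN1r -denote_somega_pow.
rewrite /star8 hodge1 -denote_sstar.
rewrite -(denote_s27 c) !inner_denote eval_normal eval_cat eval_opp eval_mul eval_pconst.
by rewrite mulrBr mulrA mulfV ?mul1r // pnatr_eq0.
Qed.

Lemma pi47_equations :
  pi47 (complexify (- wedge_pow (denote c 8 (sform2 4 8)) 2)) = 0 <->
  {in iota 1 7, forall k, eval c (eq47 k) = 0}.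
Proof.
rewrite /pi47 clin_complexify; last first.
  by apply/orth_proj_Lambda47_eq0 => k; rewrite -(scale0r 0) inner1Z mul0r.
rewrite complexify_eq0 orth_proj_Lambda47_eq0 in_iota1.
suff YE (k : 'I_7) : eval c (eq47 (lift (@ord0 7) k)) =
    - inner 1%:M (- wedge_pow (denote c 8 (sform2 4 8)) 2) (lambda4 (covec (lift ord0 k))).
  split=> Y0 k; first by rewrite YE Y0 oppr0.
  by apply: oppr_inj; rewrite -YE Y0 oppr0.
rewrite -(scaleN1r (wedge_pow _ _)) inner1Z mulN1r opprK -denote_somega_pow.
rewrite -(denote_s47 c) inner_denote.
exact: eval_normal.
Qed.

End Equations.

(** * The curvature as a value of the generic form omega *)

Section FourierMukai.
Variables (R : realType) (f : 'rV[R]_4 -> torus 4 R) (A : 'I_4 -> 'rV[R]_4 -> R).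
Variable x : 'rV[R]_4.

(** Values at x of the variables of omega: [entry i j] gets the coefficient of dA for j < 4 and the
    derivative of f^j along x^i for j >= 4. *)
Definition curvature_coef (k : nat) : R :=
  let i := inord (k %/ 8) in
  if (k %% 8 < 4)%N then
    partial i (A (inord (k %% 8))) x - partial (inord (k %% 8)) (A i) x
  else torus_partial i f (inord (k %% 8 - 4)) x.

Local Notation c := curvature_coef.

Lemma curvature_coef_base (i j : 'I_4) :
  c (entry i j) = partial i (A j) x - partial j (A i) x.
Proof.
rewrite /c /entry mulnC divnMDl // modnMDl.
have j8 : (j < 8)%N := leq_trans (ltn_ord j) (isT : (4 <= 8)%N).
by rewrite divn_small // modn_small // addn0 ltn_ord !inord_val.
Qed.

Lemma curvature_coef_fibre (i a : 'I_4) :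
  c (entry i (4 + a)) = torus_partial i f a x.
Proof.
rewrite /c /entry mulnC divnMDl // modnMDl.
have a8 : (4 + a < 8)%N by rewrite -[8%N]/(4 + 4)%N ltn_add2l.
by rewrite divn_small // modn_small // addn0 ltnNge leq_addr addKn !inord_val.
Qed.

(** Antisymmetry folds the sum over all pairs onto i < j. The map [h] lets one statement serve both
    R^4 and the base directions of R^8. *)
Lemma curvature_baseE n (h : 'I_4 -> 'I_n) :
  curvature_base (fun i => covec (h i)) A x = 'i%C *: complexify
    (\sum_(i < 4) \sum_(j < 4 | (i < j)%N)
       c (entry i j) *: @wedge n R (covec (h i)) (covec (h j))).
Proof.
pose w (i j : 'I_4) : eform n R := wedge (covec (h i)) (covec (h j)).
pose d i j := partial i (A j) x.
transitivity ('i%C *: complexify (\sum_(i < 4) \sum_(j < 4) d i j *: w i j)).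
  congr (_ *: _); rewrite complexify_sum; apply: eq_bigr => i _.
  rewrite complexify_sum; apply: eq_bigr => j _.
  by rewrite complexifyZ complexify_wedge !complexify_basis.
congr (_ *: complexify _).
have -> : \sum_(i < 4) \sum_(j < 4) d i j *: w i j =
    \sum_(i < 4) \sum_(j < 4 | (i < j)%N) d i j *: w i j +
    \sum_(i < 4) \sum_(j < 4 | (j < i)%N) d i j *: w i j.
  rewrite -big_split; apply: eq_bigr => i _ /=.
  rewrite (bigID (fun j : 'I_4 => (i < j)%N)) /=; congr (_ + _).
  rewrite (bigD1 i) ?ltnn //= /w wedge_covec_self scaler0 add0r.
  by apply: eq_bigl => j; rewrite -leqNgt ltn_neqAle andbC.
(* Exchanging the sums below the diagonal pairs each term with its mirror image above it. *)
rewrite [X in _ + X](exchange_big_dep predT) //= -big_split; apply: eq_bigr => i _ /=.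
rewrite -big_split; apply: eq_bigr => j _ /=.
by rewrite curvature_coef_base -/(d i j) -/(d j i) scalerBl /w -[wedge (covec (h j)) _]opprK
  -wedge_covecC scalerN.
Qed.

Lemma FBE : FB A x = 'i%C *: complexify (denote c 4 sbeta).
Proof.
rewrite /FB (curvature_baseE id) denote_sform2 //; congr (_ *: complexify _).
by apply: eq_bigl => i; rewrite ltn_ord.
Qed.

Lemma FSE : FS f x = 'i%C *: complexify
  (\sum_(i < 4) \sum_(a < 4) c (entry i (4 + a)) *:
     @wedge 8 R (covec (lshift 4 i)) (covec (rshift 4 a))).
Proof.
congr (_ *: _); rewrite complexify_sum; apply: eq_bigr => i _.
rewrite complexify_sum; apply: eq_bigr => a _.
by rewrite complexifyZ complexify_wedge !complexify_basis curvature_coef_fibre.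
Qed.

Lemma curvatureE y : curvature f A (x, y) = 'i%C *: complexify (denote c 8 (sform2 4 8)).
Proof.
rewrite /curvature /= (curvature_baseE (lshift 4)) FSE -scalerDr -complexifyD.
congr (_ *: complexify _); rewrite denote_sform2 //.
(* The outer index is confined to the base; the inner one is then split into its dx and dy halves,
   which give F^B and F^S. *)
rewrite (@big_split_ord _ _ _ 4 4) /= [X in _ = _ + X]big1; last first.
  by move=> i; rewrite /= -ltn_subRL.
rewrite addr0 -big_split /=; apply: eq_big => [i|i _]; first by rewrite ltn_ord.
rewrite (@big_split_ord _ _ _ 4 4) /=; congr (_ + _).
by apply: eq_bigl => a; rewrite ltn_addr.
Qed.

End FourierMukai.

(** * Derivatives of maps to the torus *)

Section Derivatives.
Variables (n : nat) (R : realType).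
Implicit Types (g h : 'rV[R]_n -> R) (x : 'rV[R]_n) (i j : 'I_n).

Lemma partial_coord i j x : partial i (fun y : 'rV[R]_n => y 0 j) x = (i == j)%:R.
Proof.
rewrite /partial /derive; apply: lim_near_cst => //.
near=> t; rewrite /= !mxE addrK /= eq_sym -[_ *: _]/(_ * _) mulrA mulVf ?mul1r //.
by near: t; exact: nbhs_dnbhs_neq.
Unshelve. all: by end_near. Qed.

Lemma partial_addr i g (k : R) x : partial i (fun y => g y + k) x = partial i g x.
Proof.
rewrite /partial /derive (_ : (fun t => _) = fun t =>
  t^-1 *: ((g \o shift x) (t *: 'e_i) - g x)) //.
by apply/funext => t; rewrite /= opprD addrACA subrr addr0.
Qed.

Lemma smooth_continuous (U : set 'rV[R]_n) g x :
  smooth U g -> U x -> {for x, continuous g}.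
Proof. by move=> gU Ux; have [gc _] := gU 0%N; exact: gc. Qed.

Lemma smooth_partial (U : set 'rV[R]_n) i g : smooth U g -> smooth U (partial i g).
Proof. by move=> gU k; have [_ /(_ i)[]] := gU k.+1. Qed.

End Derivatives.

Section TorusLifts.
Variables (n m : nat) (R : realType) (f : 'rV[R]_n -> torus m R).
Implicit Types (g h : 'rV[R]_n -> 'rV[R]_m) (x : 'rV[R]_n).

(** The difference of two lifts is continuous with values in 2 pi Z, hence locally constant. *)
Lemma local_lift_unique x g h (a : 'I_m) : local_lift f x g -> local_lift f x h ->
  \forall y \near x, g y 0 a = h y 0 a + (g x 0 a - h x 0 a).
Proof.
move=> [U [oU Ux gU fg]] [V [oV Vx hV fh]].
pose d y := g y 0 a - h y 0 a.
have dZ y : U y -> V y -> exists k : int, d y = 2 * trigo.pi * k%:~R.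
  move=> Uy Vy; have /eqmodP/asboolP[k kE] : (\pi_(torus m R) (g y) = \pi_(torus m R) (h y))%qT.
    by rewrite -fg // fh.
  by exists (k 0 a); rewrite /d kE.
have dc : {for x, continuous d}.
  have gc := smooth_continuous (gU a) Ux; have hc := smooth_continuous (hV a) Vx.
  exact: (cvgB gc hc).
have pi0 : 0 < 2 * trigo.pi :> R by rewrite mulr_gt0 // pi_gt0.
have [k0 dx] := dZ x Ux Vx.
near=> y.
have Uy : U y by near: y; exact: open_nbhs_nbhs.
have Vy : V y by near: y; exact: open_nbhs_nbhs.
have [k dy] := dZ y Uy Vy.
suff dxy : d x = d y by rewrite -/(d x) dxy /d addrC subrK.
(* Two multiples of 2 pi at distance less than 2 pi are equal. *)
have : `|d x - d y| < 2 * trigo.pi.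
  by near: y; move/cvgrPdist_lt : dc; apply.
rewrite dx dy -mulrBr normrM gtr0_norm // gtr_pMr // -intrB -intr_norm ltrz1.
by rewrite -[1]add0r ltzD1 normr_le0 subr_eq0 => /eqP ->.
Unshelve. all: by end_near. Qed.

(** [torus_lift] chooses a lift anew at each point. The fixed g is also a lift at every y near x, so
    it differs from the lift chosen at y by a constant near y; continuity of [torus_partial] follows
    from that of the derivatives of g. *)
Lemma torus_partial_near x g i (a : 'I_m) : local_lift f x g ->
  \forall y \near x, torus_partial i f a y = partial i (fun z => g z 0 a) y.
Proof.
move=> [U [oU Ux gU fg]]; near=> y.
have Uy : U y by near: y; exact: open_nbhs_nbhs.
have gy : local_lift f y g by exists U.
rewrite /torus_partial /torus_lift; case: xgetP => [h _ hy|/(_ g)//].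
rewrite /partial (near_eq_derive _ (local_lift_unique a hy gy)).
exact: (partial_addr i (fun z => g z 0 a)).
Unshelve. all: by end_near. Qed.

Lemma torus_partial_continuous (U : set 'rV[R]_n) x i (a : 'I_m) :
  smooth_to_torus U f -> U x -> {for x, continuous (torus_partial i f a)}.
Proof.
move=> fU /fU[g gx]; have near_g := torus_partial_near i a gx.
have [V [oV Vx gV _]] := gx.
have pc := smooth_continuous (smooth_partial i (gV a)) Vx.
change (torus_partial i f a y @[y --> x] --> torus_partial i f a x).
rewrite (nbhs_singleton near_g); apply: cvg_trans pc.
apply: (@near_eq_cvg _ _ (nbhs x) _ (partial i (fun z => g z 0 a))).
by apply: filterS near_g => y ->.
Qed.

End TorusLifts.

(** * Graphs *)

Lemma eval_continuous n (R : realType) (c : 'rV[R]_n -> nat -> R) (P : spoly) x :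
  (forall k, {for x, continuous (fun y => c y k)}) ->
  {for x, continuous (fun y => eval (c y) P)}.
Proof.
move=> cc; have prod_cont (s : seq nat) : {for x, continuous (fun y => \prod_(v <- s) c y v)}.
  elim: s => [|v s ih].
    rewrite (_ : (fun y => _) = cst 1); first exact: cst_continuous.
    by apply/funext => y; rewrite big_nil.
  rewrite (_ : (fun y => _) = (c ^~ v) \* (fun y => \prod_(w <- s) c y w)).
    exact: (cvgM (cc v) ih).
  by apply/funext => y; rewrite big_cons.
elim: P => [|p P ih].
  rewrite (_ : (fun y => _) = cst 0); first exact: cst_continuous.
  by apply/funext => y; rewrite eval_nil.
rewrite (_ : (fun y => _) =
    (cst p.1%:~R \* (fun y => \prod_(v <- p.2) c y v)) \+ (fun y => eval (c y) P)).
  exact: (cvgD (cvgM (cvg_cst _) (prod_cont p.2)) ih).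
by apply/funext => y; rewrite eval_cons.
Qed.

Section Graph.
Variables (R : realType).
Variables (f : 'rV[R]_4 -> torus 4 R) (A : 'I_4 -> 'rV[R]_4 -> R).

Local Notation c := (curvature_coef f A).

Lemma differential_graph_base (x : 'rV[R]_4) (i j : 'I_4) :
  differential (graph f) x (lshift 4 j) i = (j == i)%:R.
Proof.
rewrite mxE (_ : (fun y => _) = fun y : 'rV[R]_4 => y 0 j).
  by rewrite partial_coord eq_sym.
by apply/funext => y; rewrite row_mxEl.
Qed.

Lemma differential_graph_fibre (x : 'rV[R]_4) (i a : 'I_4) :
  differential (graph f) x (rshift 4 a) i = torus_partial i f a x.
Proof.
rewrite mxE (_ : (fun y => _) = fun y => torus_lift f x y 0 a) //.
by apply/funext => y; rewrite row_mxEr.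
Qed.

Lemma induced_metric_graph (x : 'rV[R]_4) :
  induced_metric (graph f) x = graph_metric (c x).
Proof.
rewrite graph_metricE; apply/matrixP => i j.
rewrite [LHS]mxE (@big_split_ord _ _ _ 4 4) /= [RHS]mxE; congr (_ + _); last first.
  rewrite [RHS]mxE; apply: eq_bigr => a _.
  rewrite [X in X * _ = _]mxE !differential_graph_fibre [X in _ = X * _]mxE.
  by rewrite [X in _ = _ * X]mxE [X in _ = _ * X]mxE !curvature_coef_fibre.
rewrite (bigD1 i) //= [X in X * _ + _]mxE !differential_graph_base eqxx mul1r.
rewrite big1 ?addr0 ?[RHS]mxE // => k /negPf ki.
by rewrite [X in X * _]mxE !differential_graph_base ki mul0r.
Qed.

Lemma pull_Phi_graph (x : 'rV[R]_4) :
  pull (differential (graph f) x) (Phi R) =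
  eval (c x) sPhi_graph *: basis_form [set: 'I_4]%SET.
Proof.
rewrite -(denote_sPhi (c x)) -(denote_spull (r := sjacobian)).
  rewrite (denote_eqb _ pull_Phi_identity) denote_fscale /denote big_seq1 ev_const scale1r.
  congr (_ *: basis_form _); apply/setP => i.
  by rewrite finset.in_setT finset.in_set mem_iota ltn_ord.
move=> k; rewrite -[k](@splitK 4 4); case: (@fintype.split 4 4 k) => [j|a] /=.
  rewrite /sjacobian ltn_ord denote_scovec (bigD1 j) //= differential_graph_base eqxx scale1r.
  by rewrite big1 ?addr0 // => i /negPf ij; rewrite differential_graph_base eq_sym ij scale0r.
rewrite /sjacobian.
rewrite /denote big_map.
have -> : iota 0 4 = index_iota 0 4 by [].
rewrite big_mkord; apply: eq_bigr => i _.
by rewrite differential_graph_fibre /ev big_seq1 mul1r curvature_coef_fibre ord_set1.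
Qed.

Lemma curvature_equations (x : 'rV[R]_4) (q : torus 4 R) :
  pi27 (curvature f A (x, q) +
        6^-1 *: clin (@star8 R) (wedge_pow (curvature f A (x, q)) 3)) = 0 /\
  pi47 (wedge_pow (curvature f A (x, q)) 2) = 0 <-> graph_equations (c x).
Proof.
rewrite /graph_equations -pi27_equations -pi47_equations curvatureE.
rewrite !wedge_pow_scale -!complexify_wedge_pow.
set w := denote _ _ _.
(* As i^2 = -1 and i^3 = -i, the square of the curvature is real while its cube is imaginary like
   the curvature itself. *)
rewrite -[X in pi47 (X *: _)]/('i%C ^+ 2) sqr_i scaleN1r -complexifyN.
have -> : 'i%C ^+ 3 *: complexify (wedge_pow w 3) =
    'i%C *: complexify (- wedge_pow w 3) :> eform 8 R[i].
  by rewrite exprS sqr_i mulrN1 scaleNr complexifyN scalerN.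
rewrite clin_scalei; last by rewrite /star8 hodge1 flat_star0.
rewrite (scalerA 6^-1 'i%C) (mulrC 6^-1 'i%C) -(scalerA 'i%C 6^-1) -scalerDr.
have c6 : (6^-1 : R)%:C = 6^-1 :> R[i] by rewrite fmorphV rmorph_nat.
have -> : star8 (- wedge_pow w 3) = - star8 (wedge_pow w 3).
  by rewrite /star8 !hodge1 -scaleN1r flat_starZ scaleN1r.
by rewrite complexifyN scalerN -c6 -complexifyZ -complexifyN -complexifyD.
Qed.

Lemma anti_self_dual_graph (x : 'rV[R]_4) (o : bool) :
  anti_self_dual (induced_metric (graph f) x) o (- 'i%C *: FB A x) <->
  hodge (graph_metric (c x)) o (denote (c x) 4 sbeta) = - denote (c x) 4 sbeta.
Proof.
(* Since F^B = i beta, the form -i F^B is beta. *)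
rewrite /anti_self_dual (FBE f) scalerA mulNr -expr2 sqr_i opprK scale1r.
rewrite induced_metric_graph clin_complexify; last first.
  by rewrite hodgeE pull0 flat_star0 scaler0.
rewrite -complexifyN; split=> [E|->//].
apply/eqP; rewrite -subr_eq0; apply/eqP/complexify_eq0.
by rewrite complexifyD E -complexifyD subrr complexify0.
Qed.

Lemma sbeta_homogeneous (x : 'rV[R]_4) : homogeneous 2 (denote (c x) 4 sbeta).
Proof. exact: homogeneous_denote. Qed.

End Graph.

(** * From the pointwise equations to the whole base *)

Theorem theorem1p2 (R : realType) (B : set 'rV[R]_4)
    (f : 'rV[R]_4 -> torus 4 R) (A : 'I_4 -> 'rV[R]_4 -> R) :
  open B -> smooth_to_torus B f -> (forall j, smooth B (A j)) ->
  (exists o : 'rV[R]_4 -> bool,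
     [/\ orientation B o,
         cayley B (graph f) o &
         forall x, B x ->
           anti_self_dual (induced_metric (graph f) x) (o x) (- 'i%C *: FB A x)])
  <->
  (forall p : spaceX R, B p.1 ->
     pi27 (curvature f A p +
           6^-1 *: clin (@star8 R) (wedge_pow (curvature f A p) 3)) = 0 /\
     pi47 (wedge_pow (curvature f A p) 2) = 0).
Proof.
move=> oB fB AB; split=> [[s [_ cal asd]] [x q] /= Bx|eqs].
  apply/curvature_equations => //; apply/graph_equationsE.
  (* The Cayley condition read on the top form: p is the signed volume density. *)
  have volE : eval (curvature_coef f A x) sPhi_graph =
      (-1) ^+ s x * Num.sqrt (\det (graph_metric (curvature_coef f A x))).
    have /ffunP/(_ [set: 'I_4]%SET) := cal x Bx.
    by rewrite (pull_Phi_graph f A) (induced_metric_graph f A) !ffunZE basis_formE eqxx !mulr1.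
  split.
    by rewrite volE exprMn sqrr_sign mul1r sqr_sqrtr // graph_metric_det_ge0.
  rewrite volE; apply/hodge_anti_self_dualE; [exact: graph_metric_unit|exact: sbeta_homogeneous|].
  exact/anti_self_dual_graph/asd.
pose p x := eval (curvature_coef f A x) sPhi_graph.
(* The curvature is constant along the torus fibres; the equations are taken at the point of the
   graph over x. *)
have geq x : B x -> graph_equations (curvature_coef f A x).
  by move=> Bx; apply/(curvature_equations f A x (f x))/(eqs (x, f x)).
(* p^2 = det g gives |p| = sqrt (det g), and p is its sign times |p|. *)
have volE x : B x -> p x = (-1) ^+ (p x < 0)%R *
    Num.sqrt (\det (graph_metric (curvature_coef f A x))).
  by move=> /geq /graph_equationsE[<- _]; rewrite sqrtr_sqr -realEsign ?num_real.
(* The orientation of the base frame is reversed exactly where p is negative. *)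
exists (fun x => (p x < 0)%R); split=> [x Bx|x Bx|x Bx].
- have pc : {for x, continuous p}.
    apply: eval_continuous => k; rewrite /curvature_coef; case: (k %% 8 < 4)%N.
      have dA i j := smooth_continuous (smooth_partial i (AB j)) Bx.
      exact: (cvgB (dA _ _) (dA _ _)).
    exact: (torus_partial_continuous fB Bx).
  (* p^2 = det g is nonzero, so by continuity p keeps its sign near x and the orientation is locally
     constant. *)
  have p0 : p x != 0.
    have /graph_equationsE[p2 _] := geq x Bx; rewrite -sqrf_eq0 p2 -unitfE -unitmxE.
    exact: graph_metric_unit.
  have [px|px] := ltP (p x) 0.
    by near=> y; apply/idP; near: y; apply: (cvgr_lt _ pc).
  have {}px : 0 < p x by rewrite lt_neqAle eq_sym p0.
  by near=> y; apply/negbTE; rewrite -leNgt ltW //; near: y; apply: (cvgr_gt _ pc).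
- by rewrite (pull_Phi_graph f A) (induced_metric_graph f A) /volume -volE.
apply/(anti_self_dual_graph f A).
apply/hodge_anti_self_dualE; [exact: graph_metric_unit|exact: sbeta_homogeneous|].
by rewrite -volE //; have /graph_equationsE[] := geq x Bx.
Unshelve. all: by end_near. Qed.
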